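(* Let $\bar A=(A_0,A_1)$ be a compatible couple of (quasi-)Banach spaces with $A_0\cap A_1\neq\{0\}$. Let $0<\theta_0<\theta_1<1$, $0<q_1,r,r_1,r_0\le\infty$, $a,a_1,b_0,b_1\in SV$, and $\left\|s^{-1/r_1}\frac{b_1(s)}{a_1(s)}\right\|_{r_1,(1,\infty)}<\infty$. Put $c_1(t)=a_1(t)\left\|s^{-1/r_1}\frac{b_1(s)}{a_1(s)}\right\|_{r_1,(t,\infty)}$ and $\rho(t)=t^{\theta_1-\theta_0}\frac{b_0(t)}{c_1(t)}$ for $t>0$. (i) If $0<\theta<1$, then $$\left(\bar A_{\theta_0,r_0,b_0},\bar A^{\mathcal L}_{\theta_1,r_1,b_1,q_1,a_1}\right)_{\theta,r,a}\cong\bar A_{\eta,r,a^{\#}},$$ where $\eta=(1-\theta)\theta_0+\theta\theta_1$ and $a^{\#}(t)=b_0(t)^{1-\theta}c_1(t)^{\theta}a(\rho(t))$. (ii) If additionally $\left\|s^{-1/r}a(s)\right\|_{r,(1,\infty)}<\infty$, then $$\left(\bar A_{\theta_0,r_0,b_0},\bar A^{\mathcal L}_{\theta_1,r_1,b_1,q_1,a_1}\right)_{0,r,a}\cong\bar A^{\mathcal L}_{\theta_0,r,a^{\#},r_0,b_0},$$ where $a^{\#}(t)=b_0(t)a(\rho(t))$.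
   Context: For a compatible couple $\bar X=(X_0,X_1)$ of (quasi-)Banach spaces, $f\in X_0+X_1$ and $t>0$, $K(t,f)=K(t,f;\bar X)=\inf\{\|f_0\|_{X_0}+t\|f_1\|_{X_1}: f=f_0+f_1,\ f_i\in X_i\}$. $\|\cdot\|_{q,(c,d)}$ ($0<q\le\infty$) is the usual (quasi-)norm of the Lebesgue space $L_q$ on the interval $(c,d)$ with Lebesgue measure (variable of integration: the displayed variable; $1/\infty=0$). $SV$ is the set of positive Lebesgue measurable functions $b$ on $(0,\infty)$ that are slowly varying: for each $\varepsilon>0$, $t^{\varepsilon}b(t)$ is equivalent to an increasing function and $t^{-\varepsilon}b(t)$ is equivalent to a decreasing function, where two positive functions are equivalent if each is bounded by a constant multiple of the other. For $0\le\theta\le1$, $0<q\le\infty$, $b\in SV$, $\bar X_{\theta,q,b}=(X_0,X_1)_{\theta,q,b}$ is the space of $f\in X_0+X_1$ with $\|f\|=\left\|u^{-\theta-1/q}b(u)K(u,f)\right\|_{q,(0,\infty)}<\infty$. For $0<\sigma<1$, $0<r,q\le\infty$, $a,b\in SV$, $\bar X^{\mathcal L}_{\sigma,r,b,q,a}$ is the space of $f\in X_0+X_1$ with $\|f\|=\left\|t^{-1/r}\frac{b(t)}{a(t)}\left\|u^{-\sigma-1/q}a(u)K(u,f)\right\|_{q,(0,t)}\right\|_{r,(0,\infty)}<\infty$. $X\cong Y$ means that $X$ and $Y$ are continuously embedded in each other (same space, equivalent quasi-norms). *)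

(* Defs.v *)
From mathcomp Require Import all_boot all_order all_algebra.
From mathcomp Require Import all_classical all_reals all_analysis.
From mathcomp Require Import measurable_realfun complex.

Set Implicit Arguments.
Unset Strict Implicit.
Unset Printing Implicit Defensive.

Import Order.TTheory GRing.Theory Num.Theory.
Import numFieldNormedType.Exports.

Local Open Scope classical_set_scope.
Local Open Scope ring_scope.

Variant scalar_kind := RealScalars | ComplexScalars.

Definition scalars (R : realType) (k : scalar_kind) : numFieldType :=
  match k with
  | RealScalars => R
  | ComplexScalars => complex R
  end.

(* In R[i] the norm `|z| is again an element of R[i] (with zero imaginary
   part), hence the real part. *)
Definition modulus (R : realType) (k : scalar_kind) : scalars R k -> R :=
  match k return scalars R k -> R with
  | RealScalars => fun a : R => `|a|
  | ComplexScalars => fun z : complex R => complex.Re `|z|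
  end.

(* A quasi-normed space X sitting inside a vector space V is represented by its
   quasi-norm, extended by +oo outside X, i.e. by a function N : V -> \bar R;
   the elements of X are the x with N x < +oo. The axioms below, read in
   \bar R, make X a linear subspace. *)
Definition carrier (R : realType) (V : Type) (N : V -> \bar R) : set V :=
  [set x | (N x < +oo)%E].

Record quasi_norm (R : realType) (k : scalar_kind)
    (V : lmodType (scalars R k)) (N : V -> \bar R) : Prop := QuasiNorm {
  qn_ge0 : forall x : V, (0 <= N x)%E;
  qn_eq0 : forall x : V, N x = 0%E <-> x = 0%R;
  qnZ : forall (c : scalars R k) (x : V), N (c *: x) = ((modulus c)%:E * N x)%E;
  qnD : exists C : R, forall x y : V, (N (x + y)%R <= C%:E * (N x + N y))%E }.

Definition quasi_complete (R : realType) (V : zmodType) (N : V -> \bar R) :=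
  forall x : nat -> V, (forall n, carrier N (x n)) ->
    (forall e : R, 0 < e -> exists n0, forall m n, (n0 <= m)%N -> (n0 <= n)%N ->
       (N (x m - x n)%R < e%:E)%E) ->
    exists2 l, carrier N l &
      forall e : R, 0 < e -> exists n0, forall n, (n0 <= n)%N ->
        (N (x n - l)%R < e%:E)%E.

Definition quasi_banach (R : realType) (k : scalar_kind)
    (V : lmodType (scalars R k)) (N : V -> \bar R) :=
  quasi_norm N /\ quasi_complete N.

Definition embedded_in_tvs (R : realType) (k : scalar_kind)
    (V : topologicalLmodType (scalars R k)) (N : V -> \bar R) :=
  forall U : set V, nbhs 0 U ->
    exists2 d : R, 0 < d & forall x, (N x < d%:E)%E -> U x.

Definition compatible_couple (R : realType) (k : scalar_kind)
    (V : topologicalLmodType (scalars R k)) (A0 A1 : V -> \bar R) :=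
  [/\ hausdorff_space V, quasi_banach A0, quasi_banach A1,
      embedded_in_tvs A0 & embedded_in_tvs A1].

(* Decompositions with f0 outside X0 or f1 outside X1 contribute +oo; hence, for
   t > 0, the value is +oo exactly when f does not belong to X0 + X1. *)
Definition Kfun (R : realType) (V : zmodType) (X0 X1 : V -> \bar R)
    (t : R) (f : V) : \bar R :=
  ereal_inf [set s | exists f0 f1, f = f0 + f1 /\ s = (X0 f0 + t%:E * X1 f1)%E].

(* The library's integral of a nonnegative function f is the supremum of the
   integrals of the (Borel) simple functions below f, and its ess_sup ignores
   all subsets of null Borel sets, so that for a Lebesgue measurable f that is
   not Borel this is still the usual quasi-norm. *)
Definition Lq (R : realType) (q : \bar R) (D : set R) (f : R -> \bar R)
    : \bar R :=
  'N[@lebesgue_measure R]_q[f \_ D].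

(* 1/q for 0 < q <= +oo; since fine +oo = 0 and 0^-1 = 0, 1/+oo is 0. *)
Definition recip (R : realType) (q : \bar R) : R := (fine q)^-1.

(* Borel measurability would be more restrictive: the domain is given the
   completion of the Borel sigma-algebra. *)
Definition Lebesgue_measurable (R : realType) (D : set R) (b : R -> R) :=
  measurable_fun (D : set (g_sigma_algebraType
    (completed_algebra_gen (@lebesgue_measure R)))) b.

Definition equivalent (R : realType) (f g : R -> R) :=
  exists2 C : R, 0 < C &
    forall t : R, 0 < t -> f t <= C * g t /\ g t <= C * f t.

Record slowly_varying (R : realType) (b : R -> R) : Prop := SlowlyVarying {
  sv_gt0 : forall t : R, 0 < t -> 0 < b t;
  sv_measurable : Lebesgue_measurable `]0, +oo[ b;
  sv_increasing : forall e : R, 0 < e -> exists2 g : R -> R,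
    (forall s t : R, 0 < s -> s <= t -> g s <= g t) &
    equivalent (fun t => t `^ e * b t) g;
  sv_decreasing : forall e : R, 0 < e -> exists2 g : R -> R,
    (forall s t : R, 0 < s -> s <= t -> g t <= g s) &
    equivalent (fun t => t `^ (- e) * b t) g }.

(* Both functionals are +oo outside X0 + X1, because Kfun is (the weights b and
   a are positive). *)
Definition interp (R : realType) (V : zmodType) (X0 X1 : V -> \bar R)
    (theta : R) (q : \bar R) (b : R -> R) (f : V) : \bar R :=
  Lq q `]0, +oo[
    (fun u => ((u `^ (- theta - recip q) * b u)%:E * Kfun X0 X1 u f)%E).

Definition interpL (R : realType) (V : zmodType) (X0 X1 : V -> \bar R)
    (sigma : R) (r : \bar R) (b : R -> R) (q : \bar R) (a : R -> R) (f : V)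
    : \bar R :=
  Lq r `]0, +oo[
    (fun t => ((t `^ (- recip r) * (b t / a t))%:E *
       Lq q `]0%R, t[
         (fun u => (u `^ (- sigma - recip q) * a u)%:E * Kfun X0 X1 u f))%E).

Definition cont_embedded (R : realType) (V : Type) (X Y : V -> \bar R) :=
  carrier X `<=` carrier Y /\
  exists2 C : R, 0 < C & forall x, carrier X x -> (Y x <= C%:E * X x)%E.

Definition same_space (R : realType) (V : Type) (X Y : V -> \bar R) :=
  cont_embedded X Y /\ cont_embedded Y X.

(* || s^(-1/r) w(s) ||_{r,(t,oo)} *)
Definition tail_norm (R : realType) (r : \bar R) (w : R -> R) (t : R)
    : \bar R :=
  Lq r `]t, +oo[ (fun s => (s `^ (- recip r) * w s)%:E).

(* Main.v *)
(** The proof samples every function at the points e^n, n an integer. Slowly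
    varying weights and K-functionals change by a bounded factor when ln t
    changes by at most 1, so each L_q norm with respect to dt/t is equivalent to
    an l_q norm of samples, and no measurability is needed. Put
    I(t) = ||u^(-theta0-1/r0) b0(u) K(u,f)||_{r0,(0,t)}, and let X0, X1 be the
    two spaces of the couple on the left. Since X1 is contained in
    A_{theta1,oo,c1}, applying I to f = f0 + f1 gives
    I(t) <= C K(rho(t),f;X0,X1). Conversely, a nearly optimal decomposition of f
    at t shows that K(rho(t),f;X0,X1) is at most C times
    I(t) + rho(t) sup_{u>=t} (u/t)^eps u^(-theta1) c1(u) K(u,f).
    After the substitution of rho(t) for the variable, the second term and, if
    theta > 0, also I(t) are absorbed by Hardy-type inequalities with geometric
    kernels. *)

Require Import Defs.
From mathcomp Require Import all_boot all_order all_algebra.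
From mathcomp Require Import all_classical all_reals all_analysis.
From mathcomp Require Import ess_sup_inf ring lra.

Set Implicit Arguments.
Unset Strict Implicit.
Unset Printing Implicit Defensive.

Import Order.TTheory GRing.Theory Num.Theory.
Import numFieldNormedType.Exports.

Local Open Scope classical_set_scope.
Local Open Scope ring_scope.

(** * Sequence norms over the integers *)

Section esum_int.
Context {R : realType}.
Implicit Types (e : R).

(** The second term of the upper estimate has no counterpart in the lower one, so K(rho(t),f;X0,X1)
    is never computed pointwise; the two estimates meet only after the norm in t is taken. This
    works because rho is the quotient of the weight of X0 by that of A_{theta1,oo,c1}: rho(u)
    u^(-theta1) c1(u) K(u,f) equals u^(-theta0) b0(u) K(u,f), essentially a single term of I(u).
    Moving rho from t to u >= t gains (t/u)^(theta1-theta0), of which the outer weight takes back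
    only the fraction theta; so theta < 1 leaves a geometric kernel, and eps has to be a small part
    of (1-theta)(theta1-theta0). Replacing I(t) by its last term needs decay of the outer weight,
    which is there exactly when theta > 0; at theta = 0 the inner norm stays and produces the space
    of type L. Exponents below 1 are allowed, so kernels are not summed by a triangle inequality:
    they are applied as suprema, which every l_q norm dominates. *)

Lemma exchange_esum (T1 T2 : choiceType) (a : T1 -> T2 -> \bar R) :
  (forall i j, 0 <= a i j)%E ->
  (\esum_(i in [set: T1]) \esum_(j in [set: T2]) a i j =
   \esum_(j in [set: T2]) \esum_(i in [set: T1]) a i j)%E.
Proof.
move=> a0; rewrite (esum_esum (J := fun=> setT))//.
rewrite (esum_esum (J := fun=> setT) (a := fun j i => a i j))//.
apply: (@reindex_esum _ _ _ _ _ (fun p : T2 * T1 => (p.2, p.1))).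
split=> //=.
- by move=> [i j] [i' j'] _ _ /= [-> ->].
- by move=> [i j] _; exists (j, i).
Qed.

Lemma esum_nat_geometric (a : nat -> R) (z : R) : 0 < z < 1 ->
  (forall n, 0 <= a n <= z ^+ n) ->
  (\esum_(n in [set: nat]) (a n)%:E <= ((1 - z)^-1)%:E)%E.
Proof.
move=> /andP[z0 z1] az.
rewrite -nneseries_esumT; last by move=> n; rewrite lee_fin; case/andP: (az n).
apply: lime_le.
  by apply: is_cvg_nneseries => n _ _; rewrite lee_fin; case/andP: (az n).
apply: nearW => n; rewrite sumEFin lee_fin.
apply: (@le_trans _ _ (\sum_(0 <= i < n) z ^+ i)).
  by apply: ler_sum => i _; case/andP: (az i).
have := @geometric_seriesE _ 1 z; rewrite lt_eqF// => /(_ isT) /(congr1 (@^~ n)).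
rewrite /series/=.
under eq_bigr do rewrite mul1r.
move=> ->; rewrite mul1r ler_piMl ?invr_ge0 ?subr_ge0 1?ltW//.
by rewrite ltrBlDr ltrDl exprn_gt0.
Qed.

Lemma esum_int_expR e : 0 < e -> exists2 G : R, 0 < G &
  forall m : int,
  (\esum_(k in [set: int]) (expR (- e * `|(k - m)%:~R|))%:E <= G%:E)%E.
Proof.
move=> e0; pose z := expR (- e).
have z01 : 0 < z < 1 by rewrite expR_gt0 expR_lt1 oppr_lt0.
have z0 : 0 <= (1 - z)^-1.
  by rewrite invr_ge0 subr_ge0 ltW//; case/andP: z01.
exists ((1 - z)^-1 + (1 - z)^-1 + 1); first by rewrite ltr_wpDl// addr_ge0.
move=> m.
rewrite -(@reindex_esum _ _ _ setT setT (fun k => k - m)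
  (fun k : int => (expR (- e * `|k%:~R|))%:E)); last first.
  split=> //; first by move=> i j _ _ /(congr1 (+%R^~ m)); rewrite !subrK.
  by move=> j _; exists (j + m); rewrite ?addrK.
rewrite (_ : [set: int] = range Posz `|` range Negz); last first.
  by apply/seteqP; split=> // -[n|n] _; [left|right]; exists n.
rewrite (esumID (range Posz)); last by move=> ? _; rewrite lee_fin expR_ge0.
rewrite setIUl setIid [range Negz `&` _](_ : _ = set0); last first.
  by apply/seteqP; split=> //= x [[n _ <-] [p _]].
rewrite setU0 setIUl setICr set0U.
rewrite [range Negz `&` _](_ : _ = range Negz); last first.
  by apply/seteqP; split=> [x []//|x/= nx]; split=> // -[p _]; case: nx => n _ <-.
rewrite !esum_image; [|by move=> i j _ _ []|by move=> i j _ _ []].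
apply: (@le_trans _ _ ((1 - z)^-1 + (1 - z)^-1)%:E); last first.
  by rewrite lee_fin lerDl.
rewrite EFinD leeD//; apply: esum_nat_geometric => // n.
  by rewrite expR_ge0/= /z -expRM_natl -pmulrn mulrN mulNr mulrC ger0_norm.
(* [Negz n] is -(n+1), so this term is z^(n+1), bounded by z^n with one factor to spare. *)
rewrite expR_ge0/= /z -expRM_natl NegzE mulrNz normrN -pmulrn ger0_norm//.
by rewrite ler_expR mulrN mulNr mulrC lerN2 ler_wpM2r ?ler_nat// ltW.
Qed.

End esum_int.

(** The index k stands for the point e^k. Values in [\bar R] let divergent sums and infinite
    K-functionals pass without side conditions. For real exponents below 1 this is only a
    quasi-norm. *)
Definition lq {R : realType} (q : \bar R) (x : int -> \bar R) : \bar R :=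
  if q is r%:E then ((\esum_(k in [set: int]) x k `^ r) `^ r^-1)%E
  else ereal_sup (range x).

Section lq.
Context {R : realType}.
Implicit Types (q : \bar R) (x y z : int -> \bar R) (r e A : R).
Local Open Scope ereal_scope.

Lemma le_poweR r (a b : \bar R) : (0 <= r)%R -> 0 <= a -> a <= b ->
  a `^ r <= b `^ r.
Proof.
move=> r0 a0 ab; apply: gt0_ler_poweR; rewrite // in_itv/= leey andbT//.
exact: le_trans ab.
Qed.

Lemma poweRVK r (a : \bar R) : (0 < r)%R -> 0 <= a -> (a `^ r) `^ r^-1 = a.
Proof. by move=> r0 a0; rewrite -poweRrM divff ?poweRe1// gt_eqF. Qed.

Lemma poweRKV r (a : \bar R) : (0 < r)%R -> 0 <= a -> (a `^ r^-1) `^ r = a.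
Proof. by move=> r0 a0; rewrite -poweRrM mulVf ?poweRe1// gt_eqF. Qed.

Lemma lq_ge0 q x : (forall k, 0 <= x k) -> 0 <= lq q x.
Proof.
by case: q => [r| |] x0 /=; [exact: poweR_ge0|..];
  apply: (le_trans (x0 0%R)); apply: ereal_sup_ubound; exists 0%R.
Qed.

Lemma lq_ge q x k : 0 < q -> (forall k, 0 <= x k) -> x k <= lq q x.
Proof.
case: q => [r| |] //= q0 x0; last by apply: ereal_sup_ubound; exists k.
rewrite -[leLHS](@poweRVK r)//; apply: le_poweR => //.
- by rewrite invr_ge0 ltW.
- exact: poweR_ge0.
rewrite -(esum_set1 (t := k) (a := fun k => x k `^ r)) ?poweR_ge0//.
by rewrite [leRHS](esumID [set k])// ?setTI ?leeDl ?esum_ge0//;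
  move=> *; exact: poweR_ge0.
Qed.

Lemma le_lq q x y : 0 < q -> (forall k, 0 <= x k) -> (forall k, x k <= y k) ->
  lq q x <= lq q y.
Proof.
case: q => [r| |] //= q0 x0 xy; last first.
  by apply: ge_ereal_sup => _ [k _ <-]; apply: le_ereal_sup_tmp; exists (y k) => //; exists k.
rewrite lte_fin in q0.
apply: le_poweR; first by rewrite invr_ge0 ltW.
  by apply: esum_ge0 => *; exact: poweR_ge0.
by apply: le_esum => k _; apply: le_poweR => //; exact: ltW.
Qed.

(** Only one inequality is proved directly; applied to c^-1 it gives the other. *)
Lemma esumZl (T : choiceType) (c : R) (a : T -> \bar R) : (0 < c)%R ->
  (forall i, 0 <= a i) ->
  \esum_(i in [set: T]) (c%:E * a i) = c%:E * \esum_(i in [set: T]) a i.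
Proof.
move=> c0 a0.
have le_esumZl (d : R) (b : T -> \bar R) : (0 < d)%R -> (forall i, 0 <= b i) ->
    \esum_(i in [set: T]) (d%:E * b i) <= d%:E * \esum_(i in [set: T]) b i.
  move=> d0 b0; apply: ge_ereal_sup => _ [X [finX XT] <-].
  rewrite fsbig_finite//= -ge0_sume_distrr//.
  apply: lee_wpmul2l; first by rewrite lee_fin ltW.
  by apply: ereal_sup_ubound; exists X => //; rewrite fsbig_finite.
apply/eqP; rewrite eq_le le_esumZl//=.
have ca0 i : 0 <= c%:E * a i by rewrite mule_ge0// lee_fin ltW.
have ci0 : (0 < c^-1)%R by rewrite invr_gt0.
have := le_esumZl _ _ ci0 ca0; rewrite lee_pdivlMl//.
apply: le_trans; apply: lee_wpmul2l; first by rewrite lee_fin ltW.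
by apply: le_esum => i _; rewrite muleA -EFinM mulVf ?mul1e// gt_eqF.
Qed.

Lemma lqZ q (c : R) x : 0 < q -> (0 < c)%R -> (forall k, 0 <= x k) ->
  lq q (fun k => c%:E * x k) = c%:E * lq q x.
Proof.
case: q => [r| |] //= q0 c0 x0; last first.
  rewrite -ereal_sup_pZl//; congr ereal_sup.
  apply/seteqP; split=> [_ [k _ <-]|_ [_ [k _ <-] <-]]; last by exists k.
  by exists (x k) => //; exists k.
rewrite lte_fin in q0.
under eq_esum do rewrite poweRM// ?lee_fin 1?ltW//.
rewrite esumZl ?powR_gt0//; last by move=> k; exact: poweR_ge0.
rewrite poweRM ?lee_fin ?powR_ge0//; last first.
  by apply: esum_ge0 => *; exact: poweR_ge0.
by rewrite -poweR_EFin poweRVK// lee_fin ltW.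
Qed.

Lemma lq0 q : 0 < q -> lq q (fun=> 0 : \bar R) = 0.
Proof.
case: q => [r| |]// q0; rewrite /lq.
  by rewrite esum1 ?poweR0r ?invr_eq0 ?gt_eqF// => k _; rewrite poweR0r ?gt_eqF.
apply/eqP; rewrite eq_le (@lq_ge0 +oo)// andbT.
by apply: ge_ereal_sup => _ [k _ <-].
Qed.

Lemma lqZ_fin q (c : \bar R) x : 0 < q -> 0 <= c -> c \is a fin_num ->
  (forall k, 0 <= x k) -> lq q (fun k => c * x k) = c * lq q x.
Proof.
case: c => [c| |]// q0; rewrite lee_fin le_eqVlt => /orP[/eqP<-|c0] _ x0.
  by under eq_fun do rewrite mul0e; rewrite lq0// mul0e.
exact: lqZ.
Qed.

(** The maximum replaces the sum because max(x,y)^r <= x^r + y^r holds for every r > 0, so exponents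
    below and above 1 are treated alike. *)
Lemma lqD q : 0 < q -> exists2 C : R, (0 < C)%R &
  forall x y, (forall k, 0 <= x k) -> (forall k, 0 <= y k) ->
  lq q (fun k => x k + y k) <= C%:E * (lq q x + lq q y).
Proof.
move=> q0.
suff [C C0 H] : exists2 C : R, (0 < C)%R &
  forall x y, (forall k, 0 <= x k) -> (forall k, 0 <= y k) ->
  lq q (fun k => maxe (x k) (y k)) <= C%:E * (lq q x + lq q y).
  exists (2 * C)%R; first by rewrite mulr_gt0.
  move=> x y x0 y0; rewrite EFinM -muleA.
  apply: (@le_trans _ _ (lq q (fun k => 2%:E * maxe (x k) (y k)))).
    apply: le_lq => // k; first by rewrite adde_ge0.
    by rewrite mule_natl mule2n leeD// le_max lexx ?orbT.
  rewrite lqZ//; first by rewrite lee_wpmul2l// H.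
  by move=> k; rewrite le_max x0.
case: q q0 => [r| |]// q0; last first.
  exists 1%R => // x y x0 y0; rewrite mul1e /=.
  apply: ge_ereal_sup => _ [k _ <-].
  have [xl yl] := (@lq_ge +oo x k q0 x0, @lq_ge +oo y k q0 y0).
  have [X0 Y0] := (@lq_ge0 +oo x x0, @lq_ge0 +oo y y0).
  by rewrite ge_max (le_trans xl) ?leeDl// (le_trans yl) ?leeDr.
rewrite lte_fin in q0.
exists (2 `^ r^-1)%R; first by rewrite powR_gt0.
move=> x y x0 y0 /=.
set X := \esum_(_ in _) (x _ `^ _); set Y := \esum_(_ in _) (y _ `^ _).
have X0 : 0 <= X by apply: esum_ge0 => *; exact: poweR_ge0.
have Y0 : 0 <= Y by apply: esum_ge0 => *; exact: poweR_ge0.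
have ri0 : (0 <= r^-1)%R by rewrite invr_ge0 ltW.
apply: (@le_trans _ _ ((2%:E * maxe X Y) `^ r^-1)).
  apply: le_poweR => //; first by apply: esum_ge0 => *; exact: poweR_ge0.
  apply: (@le_trans _ _ (X + Y)).
    rewrite -esumD; [|by move=> *; exact: poweR_ge0..].
    apply: le_esum => k _; rewrite maxEle; case: ifP => _.
      by rewrite leeDr// poweR_ge0.
    by rewrite leeDl// poweR_ge0.
  by rewrite mule_natl mule2n leeD// le_max lexx ?orbT.
rewrite poweRM ?le_max ?X0// poweR_EFin lee_wpmul2l ?lee_fin ?powR_ge0//.
rewrite maxEle; case: ifP => _; first by rewrite leeDr// poweR_ge0.
by rewrite leeDl// poweR_ge0.
Qed.

(* With tau = id this is a Hardy-type inequality, with tau a translation it gives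
   shift invariance, and with tau an approximate inverse of rho it gives the
   change of variables rho. *)
Lemma lq_hardy q A e : 0 < q -> (0 < A)%R -> (0 < e)%R ->
  exists2 C : R, (0 < C)%R & forall (tau : int -> int) x y,
    (forall k, 0 <= x k) -> (forall k, 0 <= y k) ->
    (forall k, y k <= ereal_sup (range (fun j =>
       (A * expR (- e * `|(k - tau j)%:~R|))%:E * x j))) ->
  lq q y <= C%:E * lq q x.
Proof.
case: q => [r| |] // q0 A0 e0; last first.
  exists A => // tau x y x0 y0 yx; apply: ge_ereal_sup => _ [k _ <-].
  apply: le_trans (yx k) _; apply: ge_ereal_sup => _ [j _ <-].
  apply: (@le_trans _ _ (A%:E * x j)).
    rewrite lee_wpmul2r// lee_fin ler_piMr//; first exact: ltW.
    by rewrite expR_le1 mulNr oppr_le0 mulr_ge0// ltW.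
  by rewrite lee_wpmul2l ?lee_fin ?(ltW A0)//; exact: lq_ge.
rewrite lte_fin in q0.
have [G G0 HG] := esum_int_expR (mulr_gt0 e0 q0).
exists ((A `^ r * G) `^ r^-1)%R; first by rewrite powR_gt0// mulr_gt0// powR_gt0.
move=> tau x y x0 y0 yx /=; set X := \esum_(_ in _) (x _ `^ _).
have X0 : 0 <= X by apply: esum_ge0 => *; exact: poweR_ge0.
have AG0 : (0 <= A `^ r * G)%R by rewrite mulr_ge0 ?powR_ge0// ltW.
rewrite -poweR_EFin -poweRM ?lee_fin//.
apply: le_poweR; first by rewrite invr_ge0 ltW.
  by apply: esum_ge0 => *; exact: poweR_ge0.
pose c k j := (A * expR (- e * `|(k - tau j)%:~R|))%R.
have c0 k j : (0 <= c k j)%R by rewrite mulr_ge0 ?expR_ge0// ltW.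
(* The supremum over j is at most the l_r norm in j, which after the power r is a plain sum. Once
   the sums are exchanged, each j costs a geometric series in k centred at [tau j], whose bound [G]
   does not depend on the centre; [tau] need not be injective. *)
apply: (@le_trans _ _
  (\esum_(k in [set: int]) \esum_(j in [set: int]) ((c k j)%:E * x j) `^ r)).
  apply: le_esum => k _.
  rewrite -[leRHS](@poweRKV r)//; last first.
    by apply: esum_ge0 => *; exact: poweR_ge0.
  apply: le_poweR => //; first exact: ltW.
  apply: (le_trans (yx k)).
  apply: ge_ereal_sup => _ [j _ <-].
  have cx0 i : 0 <= (c k i)%:E * x i by rewrite mule_ge0 ?lee_fin.
  exact: (@lq_ge r%:E _ j q0 cx0).
rewrite exchange_esum; last by move=> *; exact: poweR_ge0.
rewrite -esumZl ?mulr_gt0 ?powR_gt0//; last by move=> *; exact: poweR_ge0.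
apply: le_esum => j _.
apply: (@le_trans _ _ (\esum_(k in [set: int])
   (A `^ r)%:E * ((expR (- (e * r) * `|(k - tau j)%:~R|))%:E * x j `^ r))).
  apply: le_esum => k _; rewrite poweRM ?lee_fin// poweR_EFin.
  rewrite muleA -EFinM /c powRM ?expR_ge0 ?(ltW A0)// -expRM.
  rewrite (_ : - e * `|(k - tau j)%:~R| * r = - (e * r) * `|(k - tau j)%:~R|)%R//.
  by rewrite !mulNr mulrAC.
rewrite esumZl ?powR_gt0//; last first.
  by move=> k; rewrite mule_ge0 ?poweR_ge0// lee_fin expR_ge0.
rewrite EFinM -muleA lee_wpmul2l// ?lee_fin ?powR_ge0//.
have [xjy|xjy] := eqVneq (x j) +oo.
  by rewrite xjy poweRyr ?gt_eqF// gt0_muley ?leey.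
have xjf : x j \is a fin_num by rewrite ge0_fin_numE// ltey.
have [->|xj0] := eqVneq (x j) 0.
  by rewrite poweR0r ?gt_eqF// mule0 esum1// => k _; rewrite mule0.
have xj0' : (0 < fine (x j))%R.
  by rewrite fine_gt0// lt_neqAle eq_sym xj0 x0/= ltey.
rewrite -(fineK xjf) poweR_EFin.
under eq_esum do rewrite muleC.
rewrite esumZl ?powR_gt0// [leRHS]muleC.
by apply: lee_wpmul2l; rewrite ?lee_fin ?powR_ge0.
Qed.

(** This is [lq_hardy] for a point mass at m, whose l_q norm is its single value for every q. The
    cases S = +oo and S = 0 are separated so that this value is a positive real. *)
Lemma lq_geo q e : 0 < q -> (0 < e)%R ->
  exists2 G : R, (0 < G)%R & forall m x (A : R) (S : \bar R),
    (0 < A)%R -> 0 <= S -> (forall k, 0 <= x k) ->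
    (forall k, x k <= (A * expR (- e * `|(k - m)%:~R|))%:E * S) ->
  lq q x <= (G * A)%:E * S.
Proof.
move=> q0 e0; have [G G0 H] := lq_hardy q0 ltr01 e0.
exists G => // m x A S A0 S0 x0 xS.
have [->|Sy] := eqVneq S +oo; first by rewrite gt0_muley ?leey// lte_fin mulr_gt0.
have Sf : S \is a fin_num by rewrite ge0_fin_numE// ltey.
have [S'|S'] := eqVneq S 0.
  rewrite S' mule0; have -> : x = fun=> 0%E; last by rewrite lq0.
  apply/funext => k; apply/eqP; rewrite eq_le x0 andbT.
  by rewrite (le_trans (xS k))// S' mule0.
have S'0 : (0 < fine S)%R.
  by rewrite fine_gt0// lt_neqAle eq_sym S' S0/= ltey.
rewrite -(fineK Sf).
set s := fine S in S'0 *.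
pose d (j : int) : \bar R := if j == m then (A * s)%:E else 0.
have d0 j : 0 <= d j by rewrite /d; case: ifP => // _; rewrite lee_fin mulr_ge0// ltW.
have -> : (G * A)%:E * s%:E = G%:E * lq q d.
  rewrite -EFinM -mulrA EFinM; congr (_ * _); apply/eqP; rewrite eq_le.
  rewrite -[X in X <= _](_ : d m = _) ?lq_ge//=; last by rewrite /d eqxx.
  case: q q0 {H} => [r| |]// q0 /=; last first.
    apply: ge_ereal_sup => _ [k _ <-]; rewrite /d; case: ifP => // _.
    by rewrite lee_fin mulr_ge0// ltW.
  rewrite lte_fin in q0.
  rewrite -[leRHS](@poweRVK r)//; last by rewrite lee_fin mulr_ge0// ltW.
  apply: le_poweR; first by rewrite invr_ge0 ltW.
    by apply: esum_ge0 => *; exact: poweR_ge0.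
  rewrite (esumID [set m]); last by move=> *; exact: poweR_ge0.
  rewrite setTI esum_set1 ?poweR_ge0// {1}/d eqxx.
  rewrite [X in _ + X]esum1 ?adde0// => k [_ /= km].
  by rewrite /d; case: eqP => // _; rewrite poweR0r ?gt_eqF.
apply: (H id) => // k; apply: (le_trans (xS k)).
apply: le_ereal_sup_tmp; exists ((1 * expR (- e * `|(k - m)%:~R|))%:E * d m).
  by exists m.
by rewrite /d eqxx -(fineK Sf) -/s -!EFinM lee_fin mul1r mulrA (mulrC A).
Qed.

End lq.

(** * Discretization of L_q norms *)

Lemma powR_expR {R : realType} (u p : R) : 0 < u -> u `^ p = expR (p * ln u).
Proof. by move=> u0; rewrite /powR gt_eqF. Qed.

Section discretization.
Context {R : realType}.
Implicit Types (u : R) (k : int) (c x : int -> \bar R).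
Local Open Scope ereal_scope.
Local Notation mu := (@lebesgue_measure R).

(** These intervals have mass 1 for dt/t and are the level sets of the integer part of ln. *)
Definition eadic k : set R := `[expR k%:~R, expR (k + 1)%:~R[.

Lemma eadicP k u : eadic k u <-> (0 < u)%R /\ Num.floor (ln u) = k.
Proof.
rewrite /eadic /= in_itv/=; split => [/andP[ku uk]|[u0 <-]].
  have u0 : (0 < u)%R by rewrite (lt_le_trans _ ku)// expR_gt0.
  split=> //; apply: floor_def.
  by rewrite -ler_expR -ltr_expR lnK ?posrE// ku.
have /andP[a b] := floor_itv (ln u).
by rewrite -{2 3}(lnK u0) ler_expR ltr_expR a.
Qed.

Lemma measurable_eadic k : measurable (eadic k : set (measurableTypeR R)).
Proof. exact: measurable_itv. Qed.

Lemma lebesgue_measure_eadic k : mu (eadic k) = (expR k%:~R * (expR 1 - 1))%:E.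
Proof.
rewrite lebesgue_measure_itv/= lte_fin ltr_expR ltr_int ltzD1 lexx.
by rewrite -EFinD rmorphD/= expRD mulrBr mulr1.
Qed.

(* Unlike ge0_le_integral, this needs no measurability: both sides are suprema
   over the simple functions below the integrand. *)
Lemma ge0_le_integralT (f g : R -> \bar R) :
  (forall u, 0 <= f u) -> (forall u, f u <= g u) ->
  \int[mu]_u f u <= \int[mu]_u g u.
Proof.
move=> f0 fg; rewrite !ge0_integralTE//; last first.
  by move=> u; exact: le_trans (fg u).
by apply: le_ereal_sup => _ [h /= hf <-]; exists h => // u; exact: le_trans (fg u).
Qed.

Lemma integral_eadic c : (forall k, 0 <= c k) ->
  \int[mu]_u (if (0 < u)%R then c (Num.floor (ln u)) else 0) =
  \esum_(k in [set: int]) (c k * (expR k%:~R * (expR 1 - 1))%:E).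
Proof.
move=> c0.
(* Countable additivity is applied to a sequence indexed by nat, so the integers are enumerated by
   [pickle]; a natural number that codes no integer contributes the empty set. *)
pose F (n : nat) : set (measurableTypeR R) :=
  if @pickle_inv int n is Some k then eadic k else set0.
have mF n : measurable (F n).
  by rewrite /F; case: pickle_inv => // k; exact: measurable_eadic.
pose f u := if (0 < u)%R then c (Num.floor (ln u)) else 0.
have f0 u : 0 <= f u by rewrite /f; case: ifP.
have fF n : \int[mu]_(u in F n) f u =
    if @pickle_inv int n is Some k then c k * (expR k%:~R * (expR 1 - 1))%:E else 0.
  rewrite /F; case: pickle_inv => [k|]; last by rewrite integral_set0.
  rewrite (eq_integral (cst (c k))); last first.
    by move=> u; rewrite inE => /eadicP[u0 uk]; rewrite /f u0 uk.
  rewrite integral_cst; last exact: measurable_eadic.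
  by rewrite -lebesgue_measure_eadic.
have FD : \bigcup_n F n = `]0%R, +oo[%classic.
  apply/seteqP; split=> u /=.
    by rewrite in_itv/= andbT => -[n _]; rewrite /F; case: pickle_inv => [k /eadicP[]|].
  rewrite in_itv/= andbT => u0; exists (pickle (Num.floor (ln u))); first exact: I.
  by rewrite /F pickleK_inv; exact/eadicP.
transitivity (\int[mu]_(u in \bigcup_n F n) f u).
  rewrite [RHS]integral_mkcond; apply: eq_integral => u _.
  rewrite FD patchE mem_setE in_itv/= andbT.
  by rewrite /f; case: ifP.
rewrite ge0_integral_bigcup//; last 2 first.
- apply/measurable_fun_bigcup => // n; rewrite /F.
  case: pickle_inv => [k|]; last exact: measurable_fun_set0.
  move=> _ B mB; have [cB|cB] := pselect (B (c k)).
    rewrite (_ : _ `&` _ = eadic k); first exact: measurable_eadic.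
    apply/seteqP; split=> [u []//|u ku]; split=> //.
    by have /eadicP[u0 uk] := ku; rewrite /preimage/= /f u0 uk.
  rewrite (_ : _ `&` _ = set0)//.
  apply/seteqP; split=> // u [/eadicP[u0 uk]].
  by rewrite /preimage/= /f u0 uk.
- move=> i j _ _ [u []]; rewrite /F.
  case ik: (pickle_inv i) => [k|]//; case jl: (pickle_inv j) => [l|]//.
  move=> /eadicP[_ uk] /eadicP[_ ul].
  have kl : k = l by rewrite -uk -ul.
  have := @pickle_invK int i; rewrite ik/= => <-.
  by have := @pickle_invK int j; rewrite jl/= => <-; rewrite kl.
under eq_eseriesr do rewrite fF.
have E1 : (0 <= expR 1 - 1 :> R)%R by rewrite subr_ge0 ltW// pexpR_gt1.
rewrite nneseries_esumT; last first.
  by move=> n; case: pickle_inv => // k; rewrite mule_ge0// lee_fin mulr_ge0// expR_ge0.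
rewrite (esumID (range (@pickle int))); last first.
  by move=> n _; case: pickle_inv => // k; rewrite mule_ge0// lee_fin mulr_ge0// expR_ge0.
rewrite [X in _ + X]esum1 ?adde0; last first.
  move=> n [_ /= nr]; case nk: (pickle_inv n) => [k|]//; exfalso; apply: nr.
  by exists k => //; have := @pickle_invK int n; rewrite nk.
rewrite setTI esum_image; last by move=> i j _ _ ij; apply: (pcan_inj (@pickleK int)).
by apply: eq_esum => k _; rewrite pickleK_inv.
Qed.

Lemma LqE (r : R) (D : set R) (f : R -> \bar R) : (0 < r)%R ->
  Lq r%:E D f = (\int[mu]_u (`|(f \_ D) u| `^ r)) `^ r^-1.
Proof. by move=> r0; rewrite /Lq unlock. Qed.

(** The norm at +oo is an essential supremum only if the whole space has positive measure; one
    e-adic interval witnesses this. *)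
Lemma LqyE (D : set R) (f : R -> \bar R) :
  Lq +oo D f = ess_sup mu (abse \o (f \_ D)).
Proof.
rewrite /Lq unlock ifT// (@lt_le_trans _ _ (mu (eadic 0)))//.
  by rewrite lebesgue_measure_eadic lte_fin mulr_gt0 ?expR_gt0// subr_gt0 pexpR_gt1.
by apply: le_measure; rewrite ?inE//; exact: measurable_eadic.
Qed.

Lemma Lq_ge0 q (D : set R) (f : R -> \bar R) : 0 <= Lq q D f.
Proof. exact: Lnorm_ge0. Qed.

(** On the k-th interval, of length e^k (e - 1), the power r of u^(-1/r) is at most e^(-k), so each
    index contributes a factor at most e - 1. *)
Lemma le_Lq_lq (q : \bar R) : 0 < q -> exists2 C : R, (0 < C)%R &
  forall (f : R -> \bar R) x, (forall k, 0 <= x k) -> (forall u, (0 < u)%R -> 0 <= f u) ->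
    (forall u, (0 < u)%R ->
      f u <= (u `^ (- recip q))%:E * x (Num.floor (ln u))) ->
  Lq q `]0%R, +oo[ f <= C%:E * lq q x.
Proof.
case: q => [r| |]// q0; last first.
  exists 1%R => // f x x0 f0 fx; rewrite mul1e LqyE; apply/ess_supP.
  apply: nearW => u /=; rewrite patchE; case: ifPn => [|_]; last first.
    by rewrite abse0; exact: (@lq_ge0 _ +oo).
  rewrite mem_setE in_itv/= andbT => u0; rewrite gee0_abs ?f0//.
  apply: le_trans (fx _ u0) _.
  rewrite /recip/= invr0 oppr0 powRr0 mul1e; exact: (@lq_ge _ +oo).
rewrite lte_fin in q0.
have E0 : (0 < expR 1 - 1 :> R)%R by rewrite subr_gt0 pexpR_gt1.
exists ((expR 1 - 1) `^ r^-1)%R; first by rewrite powR_gt0.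
move=> f x x0 f0 fx; rewrite LqE//= -poweR_EFin -poweRM; last 2 first.
- by rewrite lee_fin ltW.
- by apply: esum_ge0 => *; exact: poweR_ge0.
pose c k := (expR (- k%:~R))%:E * (x k `^ r).
have c0 k : 0 <= c k by rewrite mule_ge0 ?poweR_ge0// lee_fin expR_ge0.
apply: le_poweR; first by rewrite invr_ge0 ltW.
  by apply: integral_ge0 => u _; exact: poweR_ge0.
apply: (@le_trans _ _
  (\int[mu]_u (if (0 < u)%R then c (Num.floor (ln u)) else 0))).
  apply: ge0_le_integralT => u; first exact: poweR_ge0.
  rewrite patchE mem_setE in_itv/= andbT; case: ifPn => u0; last first.
    by rewrite abse0 poweR0r// gt_eqF.
  rewrite gee0_abs ?f0//.
  apply: le_trans (le_poweR (ltW q0) (f0 _ u0) (fx _ u0)) _.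
  rewrite poweRM ?lee_fin ?powR_ge0// poweR_EFin -powRrM.
  rewrite /recip/= mulNr mulVf ?gt_eqF// /c; apply: lee_wpmul2r.
    exact: poweR_ge0.
  by rewrite lee_fin powR_expR// ler_expR mulN1r lerN2 floor_le.
rewrite integral_eadic// -esumZl//; last by move=> *; exact: poweR_ge0.
apply: le_esum => k _; rewrite /c [leLHS]muleC muleA -EFinM mulrAC -expRD.
by rewrite subrr expR0 mul1r.
Qed.

Lemma le_lq_Lq (q : \bar R) : 0 < q -> exists2 C : R, (0 < C)%R &
  forall (f : R -> \bar R) x, (forall k, 0 <= x k) -> (forall u, (0 < u)%R -> 0 <= f u) ->
    (forall u, (0 < u)%R ->
      (u `^ (- recip q))%:E * x (Num.floor (ln u)) <= f u) ->
  lq q x <= C%:E * Lq q `]0%R, +oo[ f.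
Proof.
case: q => [r| |]// q0; last first.
  exists 1%R => // f x x0 f0 fx; rewrite mul1e LqyE.
  apply: ge_ereal_sup => _ [k _ <-]; rewrite leNgt; apply/negP => ltk.
  (* If x k exceeded the essential supremum, the whole k-th e-adic interval would lie in a null
     set. *)
  have [N [mN N0 HN]] := ess_sup_ge mu (abse \o (f \_ `]0%R, +oo[)).
  suff : mu (eadic k) <= mu N.
    rewrite N0 lebesgue_measure_eadic lee_fin leNgt.
    by rewrite mulr_gt0 ?expR_gt0// subr_gt0 pexpR_gt1.
  apply: le_measure; rewrite ?inE//; first exact: measurable_eadic.
  move=> u /eadicP[u0 uk]; apply: HN => /=; apply/negP; rewrite -ltNge.
  rewrite patchE mem_setE in_itv/= andbT u0 gee0_abs ?f0//.
  apply: (lt_le_trans ltk); apply: le_trans (fx _ u0).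
  by rewrite uk /recip/= invr0 oppr0 powRr0 mul1e.
rewrite lte_fin in q0.
have E0 : (0 < expR 1 - 1 :> R)%R by rewrite subr_gt0 pexpR_gt1.
have B0 : (0 < expR 1 / (expR 1 - 1) :> R)%R by rewrite divr_gt0// expR_gt0.
(* Here 1/u is bounded below by e^(-(k+1)), at the far end of the interval; this costs the extra
   factor e. *)
exists ((expR 1 / (expR 1 - 1)) `^ r^-1)%R; first by rewrite powR_gt0.
move=> f x x0 f0 fx; rewrite LqE//= -poweR_EFin -poweRM; last 2 first.
- by rewrite lee_fin ltW.
- by apply: integral_ge0 => u _; exact: poweR_ge0.
pose c k := (expR (- (k + 1)%:~R))%:E * (x k `^ r).
have c0 k : 0 <= c k by rewrite mule_ge0 ?poweR_ge0// lee_fin expR_ge0.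
apply: le_poweR; first by rewrite invr_ge0 ltW.
  by apply: esum_ge0 => *; exact: poweR_ge0.
apply: (@le_trans _ _ ((expR 1 / (expR 1 - 1))%:E *
  \int[mu]_u (if (0 < u)%R then c (Num.floor (ln u)) else 0))); last first.
  apply: lee_wpmul2l; first by rewrite lee_fin ltW.
  apply: ge0_le_integralT => u; first by case: ifP.
  rewrite patchE mem_setE in_itv/= andbT; case: ifPn => u0; last exact: poweR_ge0.
  rewrite gee0_abs ?f0//.
  have fx0 : 0 <= (u `^ (- recip r%:E))%:E * x (Num.floor (ln u)).
    by rewrite mule_ge0// lee_fin powR_ge0.
  apply: le_trans (le_poweR (ltW q0) fx0 (fx _ u0)).
  rewrite poweRM ?lee_fin ?powR_ge0// poweR_EFin -powRrM.
  rewrite /recip/= mulNr mulVf ?gt_eqF// /c; apply: lee_wpmul2r.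
    exact: poweR_ge0.
  by rewrite lee_fin powR_expR// ler_expR mulN1r lerN2 ltW// floorD1_gt.
rewrite integral_eadic// -esumZl//; last first.
  by move=> k; rewrite mule_ge0// lee_fin mulr_ge0 ?expR_ge0// ltW.
apply: le_esum => k _; rewrite /c [X in _ * X]muleC !muleA -!EFinM.
rewrite (_ : _ * _ = 1)%R ?mul1e// rmorphD/= opprD expRD !expRN.
have ek : (expR k%:~R != 0 :> R)%R by rewrite gt_eqF// expR_gt0.
have e1 : (expR 1 != 0 :> R)%R by rewrite gt_eqF// expR_gt0.
have e2 : (expR 1 - 1 != 0 :> R)%R by rewrite gt_eqF.
by field; rewrite ek e1 e2.
Qed.

End discretization.

(** * Slow variation and sampling *)

Section potter.
Context {R : realType}.
Implicit Types (b c : R -> R) (s t u : R).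

(* Potter's bounds b(s)/b(t) <= C max(s/t, t/s)^e, in logarithmic form. *)
Definition potter b := (forall t, 0 < t -> 0 < b t) /\
  forall e, 0 < e -> exists M, forall s t, 0 < s -> 0 < t ->
    `|ln (b s) - ln (b t)| <= M + e * `|ln s - ln t|.

Lemma potterM b c : potter b -> potter c -> potter (fun t => b t * c t).
Proof.
move=> [b0 Hb] [c0 Hc]; split=> [t t0|e e0]; first by rewrite mulr_gt0 ?b0 ?c0.
have e2 : 0 < e / 2 by rewrite divr_gt0.
have [[M HM] [N HN]] := (Hb _ e2, Hc _ e2); exists (M + N) => s t s0 t0.
rewrite !lnM ?posrE ?b0 ?c0//.
have := lerD (HM _ _ s0 t0) (HN _ _ s0 t0).
have := ler_normD (ln (b s) - ln (b t)) (ln (c s) - ln (c t)).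
rewrite (_ : _ + (ln (c s) - _) = ln (b s) + ln (c s) - (ln (b t) + ln (c t)));
  last by ring.
move=> /le_trans h /h /le_trans; apply; apply/eqP.
by rewrite eq_sym le_eqVlt; apply/orP; left; apply/eqP; field.
Qed.

Lemma potterV b : potter b -> potter (fun t => (b t)^-1).
Proof.
move=> [b0 Hb]; split=> [t t0|e e0]; first by rewrite invr_gt0 b0.
have [M HM] := Hb _ e0; exists M => s t s0 t0.
by rewrite !lnV ?posrE ?b0// -opprD normrN HM.
Qed.

Lemma potter_div b c : potter b -> potter c -> potter (fun t => b t / c t).
Proof. by move=> pb /potterV; exact: potterM. Qed.

Lemma potter_powR b p : potter b -> potter (fun t => b t `^ p).
Proof.
move=> [b0 Hb]; split=> [t t0|e e0]; first by rewrite powR_gt0 ?b0.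
(* The summand 1 keeps the divisor positive when p = 0. *)
have p0 : 0 < `|p| + 1 by rewrite ltr_wpDl.
have [M HM] := Hb _ (divr_gt0 e0 p0); exists ((`|p| + 1) * M) => s t s0 t0.
rewrite !ln_powR -mulrBr normrM.
apply: (@le_trans _ _ ((`|p| + 1) * `|ln (b s) - ln (b t)|)).
  by rewrite ler_wpM2r// lerDl.
apply: le_trans (ler_wpM2l (ltW p0) (HM _ _ s0 t0)) _.
by rewrite mulrDr mulrA mulrCA divff ?gt_eqF// mulr1.
Qed.

(** Since [e] is arbitrary, it can be divided by the Lipschitz constant [D]; the additive error [M]
    only changes the constant. No monotonicity or continuity of [rho] enters. *)
Lemma potter_comp b rho : potter b -> (forall t, 0 < t -> 0 < rho t) ->
  (exists M D, 0 < D /\ forall s t, 0 < s -> 0 < t ->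
    `|ln (rho s) - ln (rho t)| <= M + D * `|ln s - ln t|) ->
  potter (fun t => b (rho t)).
Proof.
move=> [b0 Hb] rho0 [M [D [D0 HD]]]; split=> [t t0|e e0]; first by rewrite b0 ?rho0.
have eD : 0 < e / D by rewrite divr_gt0.
have [N HN] := Hb _ eD; exists (N + e / D * M) => s t s0 t0.
apply: le_trans (HN _ _ (rho0 _ s0) (rho0 _ t0)) _; rewrite -addrA lerD2l.
apply: le_trans (ler_wpM2l (ltW eD) (HD _ _ s0 t0)) _.
by rewrite mulrDr mulrA divfK ?gt_eqF.
Qed.

Lemma potter_le b e : potter b -> 0 < e -> exists2 C : R, 0 < C &
  forall s t, 0 < s -> 0 < t -> b s <= C * expR (e * `|ln s - ln t|) * b t.
Proof.
move=> [b0 Hb] e0; have [M HM] := Hb _ e0.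
exists (expR M) => [|s t s0 t0]; first exact: expR_gt0.
rewrite -expRD -(lnK (b0 _ s0)) -(lnK (b0 _ t0)) -expRD ler_expR.
by rewrite -lerBlDr (le_trans (ler_norm _))// HM.
Qed.

Lemma le_potter b : (forall t, 0 < t -> 0 < b t) ->
  (forall e, 0 < e -> exists2 C : R, 0 < C &
    forall s t, 0 < s -> 0 < t -> b s <= C * expR (e * `|ln s - ln t|) * b t) ->
  potter b.
Proof.
move=> b0 Hb; split=> // e /Hb[C C0 HC]; exists (ln C) => s t s0 t0.
have le s' t' : 0 < s' -> 0 < t' ->
    ln (b s') - ln (b t') <= ln C + e * `|ln s' - ln t'|.
  move=> s'0 t'0; have := HC _ _ s'0 t'0.
  rewrite -ler_ln ?posrE ?mulr_gt0 ?expR_gt0 ?b0//.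
  by rewrite !lnM ?posrE ?mulr_gt0 ?expR_gt0 ?b0// expRK lerBlDr.
rewrite ler_norml le// lerNl opprB andbT.
by rewrite [X in e * X]distrC le.
Qed.

Lemma potter_eadic b e : potter b -> 0 < e -> exists2 C : R, 0 < C &
  forall j k : int, b (expR k%:~R) <= C * expR (e * `|(k - j)%:~R|) * b (expR j%:~R).
Proof.
move=> pb e0; have [C C0 HC] := potter_le pb e0; exists C => // j k.
have := HC (expR k%:~R) (expR j%:~R) (expR_gt0 _) (expR_gt0 _).
by rewrite !expRK rmorphB.
Qed.

(** Potter's bound with exponent d/2 spends half of the decay of e^(-dk); the other half survives as
    a geometric kernel. *)
Lemma potter_decay b d : potter b -> 0 < d -> exists2 C : R, 0 < C &
  forall j k : int, j <= k ->
    expR (- d * k%:~R) * b (expR k%:~R) <=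
    C * expR (- (d / 2) * `|(k - j)%:~R|) * (expR (- d * j%:~R) * b (expR j%:~R)).
Proof.
move=> pb d0; have d2 : 0 < d / 2 by rewrite divr_gt0.
have [C C0 HC] := potter_eadic pb d2; exists C => // j k jk.
apply: le_trans (ler_wpM2l (expR_ge0 _) (HC j k)) _.
rewrite le_eqVlt; apply/orP; left; apply/eqP.
have eE : expR (- d * k%:~R) * expR (d / 2 * `|(k - j)%:~R|) =
    expR (- (d / 2) * `|(k - j)%:~R|) * expR (- d * j%:~R).
  by rewrite -!expRD; congr expR; rewrite ger0_norm ?ler0z ?subr_ge0// rmorphB/=; lra.
transitivity (C * (expR (- d * k%:~R) * expR (d / 2 * `|(k - j)%:~R|)) *
  b (expR j%:~R)); first by ring.
by rewrite eE; ring.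
Qed.

Lemma potter_growth b d : potter b -> 0 < d -> exists2 C : R, 0 < C &
  forall j k : int, k <= j ->
    expR (d * k%:~R) * b (expR k%:~R) <=
    C * expR (- (d / 2) * `|(k - j)%:~R|) * (expR (d * j%:~R) * b (expR j%:~R)).
Proof.
move=> pb d0; have d2 : 0 < d / 2 by rewrite divr_gt0.
have [C C0 HC] := potter_eadic pb d2; exists C => // j k jk.
apply: le_trans (ler_wpM2l (expR_ge0 _) (HC j k)) _.
rewrite le_eqVlt; apply/orP; left; apply/eqP.
have eE : expR (d * k%:~R) * expR (d / 2 * `|(k - j)%:~R|) =
    expR (- (d / 2) * `|(k - j)%:~R|) * expR (d * j%:~R).
  by rewrite -!expRD; congr expR; rewrite ler0_norm ?lerz0 ?subr_le0// rmorphB/=; lra.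
transitivity (C * (expR (d * k%:~R) * expR (d / 2 * `|(k - j)%:~R|)) *
  b (expR j%:~R)); first by ring.
by rewrite eE; ring.
Qed.

(** The almost increasing function t^e b(t) limits how fast b can fall, the almost decreasing t^(-e)
    b(t) how fast it can rise. Each passage through an equivalent monotone function uses its
    constant twice. *)
Lemma slowly_varying_potter b : slowly_varying b -> potter b.
Proof.
move=> [b0 _ incr decr]; split=> // e e0.
have [g gle [C C0 HC]] := incr _ e0; have [h hge [D D0 HD]] := decr _ e0.
have up s t : 0 < s -> s <= t -> ln (b s) - ln (b t) <= ln C + ln C + e * (ln t - ln s).
  move=> s0 st; have t0 : 0 < t by exact: lt_le_trans st.
  have : s `^ e * b s <= C * (C * (t `^ e * b t)).
    have [h1 _] := HC _ s0; have [_ h2] := HC _ t0.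
    by apply: le_trans h1 _; rewrite ler_wpM2l ?(ltW C0)// (le_trans _ h2) ?gle.
  rewrite -ler_ln ?posrE ?mulr_gt0 ?powR_gt0 ?b0//.
  rewrite !lnM ?posrE ?mulr_gt0 ?powR_gt0 ?b0// !ln_powR; lra.
have dn s t : 0 < s -> s <= t -> ln (b t) - ln (b s) <= ln D + ln D + e * (ln t - ln s).
  move=> s0 st; have t0 : 0 < t by exact: lt_le_trans st.
  have : t `^ (- e) * b t <= D * (D * (s `^ (- e) * b s)).
    have [h1 _] := HD _ t0; have [_ h2] := HD _ s0.
    by apply: le_trans h1 _; rewrite ler_wpM2l ?(ltW D0)// (le_trans _ h2) ?hge.
  rewrite -ler_ln ?posrE ?mulr_gt0 ?powR_gt0 ?b0//.
  rewrite !lnM ?posrE ?mulr_gt0 ?powR_gt0 ?b0// !ln_powR; lra.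
(* ln C and ln D may be negative; absolute values let one constant serve both directions. *)
exists (`|ln C + ln C| + `|ln D + ln D|) => s t s0 t0.
have key s' t' : 0 < s' -> s' <= t' -> `|ln (b s') - ln (b t')| <=
    `|ln C + ln C| + `|ln D + ln D| + e * `|ln s' - ln t'|.
  move=> s0' st'; have := up _ _ s0' st'; have := dn _ _ s0' st'.
  have := ler_norm (ln C + ln C); have := ler_norm (ln D + ln D).
  have := normr_ge0 (ln C + ln C); have := normr_ge0 (ln D + ln D).
  have -> : `|ln s' - ln t'| = ln t' - ln s'.
    by rewrite distrC ger0_norm// subr_ge0 ler_ln ?posrE// (lt_le_trans s0').
  by rewrite ler_norml; move=> *; apply/andP; split; lra.
have [st|/ltW ts] := leP s t; first exact: key.
by rewrite distrC [X in _ + e * X]distrC key.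
Qed.

End potter.

(** * Comparison of L_q norms with norms of samples *)

Definition ecomp {R : realType} (C : R) (x y : \bar R) : Prop :=
  (x <= C%:E * y)%E /\ (y <= C%:E * x)%E.

Definition lower (R : realType) (k : int) (x : int -> \bar R) (j : int) : \bar R :=
  if j <= k then x j else 0%E.

Definition upper (R : realType) (k : int) (x : int -> \bar R) (j : int) : \bar R :=
  if k <= j then x j else 0%E.

Section sampling.
Context {R : realType}.
Implicit Types (u s t : R) (k : int) (x y : int -> \bar R) (F : R -> \bar R) (q : \bar R).
Local Open Scope ereal_scope.

Lemma ecompC (C : R) (x y : \bar R) : ecomp C x y -> ecomp C y x.
Proof. by case. Qed.

Lemma lee_trans_mul (A B : R) (x y z : \bar R) : (0 < A)%R ->
  x <= A%:E * y -> y <= B%:E * z -> x <= (A * B)%:E * z.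
Proof.
move=> A0 xy yz; apply: le_trans xy _; rewrite EFinM -muleA.
by apply: lee_wpmul2l => //; rewrite lee_fin ltW.
Qed.

Lemma ecomp_trans (A B : R) (x y z : \bar R) : (0 < A)%R -> (0 < B)%R ->
  ecomp A x y -> ecomp B y z -> ecomp (A * B)%R x z.
Proof.
move=> A0 B0 [xy yx] [yz zy]; split; first exact: lee_trans_mul yz.
by rewrite mulrC; exact: lee_trans_mul yx.
Qed.

Lemma lee_mulW (A B : R) (y : \bar R) : 0 <= y -> (A <= B)%R ->
  A%:E * y <= B%:E * y.
Proof. by move=> y0 AB; apply: lee_wpmul2r => //; rewrite lee_fin. Qed.

Lemma lower_ge0 k x : (forall j, 0 <= x j) -> forall j, 0 <= lower k x j.
Proof. by move=> x0 j; rewrite /lower; case: ifP. Qed.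

Lemma upper_ge0 k x : (forall j, 0 <= x j) -> forall j, 0 <= upper k x j.
Proof. by move=> x0 j; rewrite /upper; case: ifP. Qed.

(** The constant does not depend on the shift m: the kernel of [lq_hardy] is used only at its peak,
    j = k + m. *)
Lemma lq_shift q : 0 < q -> exists2 C : R, (0 < C)%R &
  forall m (M : R) x y, (0 < M)%R -> (forall k, 0 <= x k) -> (forall k, 0 <= y k) ->
    (forall k, y k <= M%:E * x (k + m)%R) -> lq q y <= (C * M)%:E * lq q x.
Proof.
move=> q0; have [C C0 H] := lq_hardy q0 ltr01 (@ltr01 R).
exists C => // m M x y M0 x0 y0 yx.
rewrite EFinM -muleA -lqZ//.
have Mx0 k : 0 <= M%:E * x k by rewrite mule_ge0// lee_fin ltW.
apply: (H (fun j => j - m)%R) => // k; apply: (le_trans (yx k)).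
apply: le_ereal_sup_tmp.
exists ((1 * expR (-1 * `|(k - (k + m - m))%:~R|))%:E * (M%:E * x (k + m)%R)).
  by exists (k + m)%R.
by rewrite addrK subrr normr0 mulr0 expR0 mul1r mul1e.
Qed.

Lemma Lq_le_lq q (M : R) : 0 < q -> (0 < M)%R -> exists2 C : R, (0 < C)%R &
  forall F x, (forall k, 0 <= x k) -> (forall u, (0 < u)%R -> 0 <= F u) ->
    (forall u, (0 < u)%R -> F u <= M%:E * x (Num.floor (ln u))) ->
  Lq q `]0%R, +oo[ (fun u => (u `^ (- recip q))%:E * F u) <= C%:E * lq q x.
Proof.
move=> q0 M0; have [C C0 H] := le_Lq_lq q0.
exists (C * M)%R; first exact: mulr_gt0.
move=> F x x0 F0 Fx; rewrite EFinM -muleA -lqZ//; apply: H => [k|u u0|u u0].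
- by rewrite mule_ge0// lee_fin ltW.
- by rewrite mule_ge0 ?F0// lee_fin powR_ge0.
- by apply: lee_wpmul2l; rewrite ?lee_fin ?powR_ge0// Fx.
Qed.

Lemma lq_le_Lq q (M : R) : 0 < q -> (0 < M)%R -> exists2 C : R, (0 < C)%R &
  forall F x, (forall k, 0 <= x k) -> (forall u, (0 < u)%R -> 0 <= F u) ->
    (forall u, (0 < u)%R -> x (Num.floor (ln u)) <= M%:E * F u) ->
  lq q x <= C%:E * Lq q `]0%R, +oo[ (fun u => (u `^ (- recip q))%:E * F u).
Proof.
move=> q0 M0; have [C C0 H] := le_lq_Lq q0.
exists (M * C)%R; first exact: mulr_gt0.
have M0' : (0 < M^-1)%R by rewrite invr_gt0.
move=> F x x0 F0 xF; rewrite EFinM -muleA -lee_pdivrMl// -lqZ//.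
apply: H => [k|u u0|u u0].
- by rewrite mule_ge0// lee_fin ltW.
- by rewrite mule_ge0 ?F0// lee_fin powR_ge0.
- by apply: lee_wpmul2l; rewrite ?lee_fin ?powR_ge0// lee_pdivrMl// xF.
Qed.

Lemma eq_Lq q (D : set R) (f g : R -> \bar R) :
  (forall u, D u -> f u = g u) -> Lq q D f = Lq q D g.
Proof.
move=> fg; rewrite /Lq; congr (Lnorm _ _ _); apply/funext => u.
by rewrite !patchE; case: ifPn => //; rewrite inE => /fg.
Qed.

Lemma Lq_restrict q (D E : set R) (f : R -> \bar R) : D `<=` E ->
  Lq q D f = Lq q E (f \_ D).
Proof.
move=> DE; rewrite /Lq; congr (Lnorm _ _ _); apply/funext => u.
rewrite !patchE; case: ifPn => [|_]; last by case: ifP.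
by rewrite inE => /DE uE; rewrite mem_set.
Qed.

(** Unit logarithmic distance is the width of an e-adic interval, so one value represents F on the
    whole interval up to the factor M. *)
Definition tame (M : R) F := (forall u, (0 < u)%R -> 0 <= F u) /\
  forall s t, (0 < s)%R -> (0 < t)%R -> (`|ln s - ln t| <= 1)%R -> F s <= M%:E * F t.

Definition sample F k : \bar R := F (expR k%:~R).

Lemma ln_floor_le1 u k : (k = Num.floor (ln u) -> `|ln u - ln (expR k%:~R)| <= 1)%R.
Proof.
move=> ->; rewrite expRK; have := floor_itv (ln u); rewrite rmorphD/= => /andP[a b].
by rewrite ler_norml; apply/andP; split; lra.
Qed.

Lemma tame_sample M F k : tame M F -> sample F (k + 1) <= M%:E * sample F k /\
  sample F k <= M%:E * sample F (k + 1).
Proof.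
move=> [_ H]; split; apply: H; rewrite ?expR_gt0// !expRK rmorphD/=.
- by rewrite addrAC subrr add0r normr1.
- by rewrite opprD addrA subrr add0r normrN1.
Qed.

Lemma Lq_sample q (M : R) : 0 < q -> (0 < M)%R -> exists2 C : R, (0 < C)%R &
  forall F, tame M F ->
  ecomp C (Lq q `]0%R, +oo[ (fun u => (u `^ (- recip q))%:E * F u))
    (lq q (sample F)).
Proof.
move=> q0 M0; have [A A0 HA] := Lq_le_lq q0 M0; have [B B0 HB] := lq_le_Lq q0 M0.
exists (A + B)%R; first exact: addr_gt0.
move=> F tF; have [F0 HF] := tF.
have x0 k : 0 <= sample F k by rewrite F0 ?expR_gt0.
split.
  apply: (@le_trans _ _ (A%:E * lq q (sample F))); last first.
    by apply: lee_mulW; [exact: lq_ge0|rewrite lerDl ltW].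
  by apply: HA => // u u0; apply: HF; rewrite ?expR_gt0// ln_floor_le1.
apply: le_trans (HB F _ x0 F0 _) _ => [u u0|].
  by apply: HF; rewrite ?expR_gt0// distrC ln_floor_le1.
by apply: lee_mulW; [exact: Lq_ge0|rewrite lerDr ltW].
Qed.

(** The function cut off at t is not tame across t, so [Lq_sample] does not apply to it and the two
    one-sided bounds are used instead. *)
Lemma Lq_sample_lower q (M : R) : 0 < q -> (0 < M)%R -> exists2 C : R, (0 < C)%R &
  forall F, tame M F -> forall t, (0 < t)%R ->
  ecomp C (Lq q `]0%R, t[ (fun u => (u `^ (- recip q))%:E * F u))
    (lq q (lower (Num.floor (ln t)) (sample F))).
Proof.
move=> q0 M0; have [A A0 HA] := Lq_le_lq q0 M0; have [B B0 HB] := lq_le_Lq q0 M0.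
have [S S0 HS] := lq_shift q0.
have B0' : (0 < S * M * B)%R by rewrite !mulr_gt0.
exists (A + S * M * B)%R; first exact: addr_gt0.
move=> F tF t t0; have [F0 HF] := tF; set k := Num.floor (ln t).
have x0 j : 0 <= sample F j by rewrite F0 ?expR_gt0.
pose G := F \_ `]0%R, t[.
have GE u : (0 < u)%R -> G u = if (u < t)%R then F u else 0.
  by move=> u0; rewrite /G patchE mem_setE in_itv/= u0.
have G0 u : (0 < u)%R -> 0 <= G u by move=> u0; rewrite GE//; case: ifP; rewrite ?F0.
have -> : Lq q `]0%R, t[ (fun u => (u `^ (- recip q))%:E * F u) =
    Lq q `]0%R, +oo[ (fun u => (u `^ (- recip q))%:E * G u).
  rewrite (@Lq_restrict _ `]0%R, t[ `]0%R, +oo[).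
    apply: eq_Lq => u /=; rewrite in_itv/= andbT => u0.
    by rewrite GE// patchE mem_setE in_itv/= u0/=; case: ifP; rewrite ?mule0.
  by move=> u /=; rewrite !in_itv/= => /andP[->].
split.
  apply: (@le_trans _ _ (A%:E * lq q (lower k (sample F)))); last first.
    by apply: lee_mulW; [exact/lq_ge0/lower_ge0|rewrite lerDl ltW].
  apply: HA => //; first exact: lower_ge0.
  move=> u u0; rewrite GE// /lower; case: ifPn => [ut|_]; last first.
    by case: ifP; rewrite ?mule0// mule_ge0// lee_fin ltW.
  rewrite ifT; last by apply: le_floor; rewrite ler_ln ?posrE// ltW.
  by apply: HF; rewrite ?expR_gt0// ln_floor_le1.
(* The k-th interval may lie only partly in (0,t), so the integral controls the samples up to k - 1;
   tameness and a shift by one recover the k-th. *)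
apply: (@le_trans _ _ ((S * M)%:E * lq q (lower (k - 1) (sample F)))).
  apply: (HS (-1)%R) => //; [exact: lower_ge0|exact: lower_ge0|].
  move=> j; rewrite /lower lerD2r; case: ifP => _; last by rewrite mule0.
  by have [+ _] := tame_sample (j - 1) tF; rewrite subrK.
apply: (@le_trans _ _ ((S * M * B)%:E *
    Lq q `]0%R, +oo[ (fun u => (u `^ (- recip q))%:E * G u))); last first.
  by apply: lee_mulW; [exact: Lq_ge0|rewrite lerDr ltW].
apply: lee_trans_mul (lexx _) _; first exact: mulr_gt0.
apply: HB => //; first exact: lower_ge0.
move=> u u0; rewrite /lower; case: ifPn => [uk|_]; last by rewrite mule_ge0 ?G0// lee_fin ltW.
rewrite GE// ifT; first by apply: HF; rewrite ?expR_gt0// distrC ln_floor_le1.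
rewrite -ltr_ln ?posrE// (lt_le_trans (floorD1_gt _))//.
by rewrite (le_trans _ (floor_le (ln t)))// ler_int -lerBrDr.
Qed.

Lemma Lq_sample_upper q (M : R) : 0 < q -> (0 < M)%R -> exists2 C : R, (0 < C)%R &
  forall F, tame M F -> forall t, (0 < t)%R ->
  ecomp C (Lq q `]t, +oo[ (fun u => (u `^ (- recip q))%:E * F u))
    (lq q (upper (Num.floor (ln t)) (sample F))).
Proof.
move=> q0 M0; have [A A0 HA] := Lq_le_lq q0 M0; have [B B0 HB] := lq_le_Lq q0 M0.
have [S S0 HS] := lq_shift q0.
have B0' : (0 < S * M * B)%R by rewrite !mulr_gt0.
exists (A + S * M * B)%R; first exact: addr_gt0.
move=> F tF t t0; have [F0 HF] := tF; set k := Num.floor (ln t).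
have x0 j : 0 <= sample F j by rewrite F0 ?expR_gt0.
pose G := F \_ `]t, +oo[.
have GE u : (0 < u)%R -> G u = if (t < u)%R then F u else 0.
  by move=> u0; rewrite /G patchE mem_setE in_itv/= andbT.
have G0 u : (0 < u)%R -> 0 <= G u by move=> u0; rewrite GE//; case: ifP; rewrite ?F0.
have -> : Lq q `]t, +oo[ (fun u => (u `^ (- recip q))%:E * F u) =
    Lq q `]0%R, +oo[ (fun u => (u `^ (- recip q))%:E * G u).
  rewrite (@Lq_restrict _ `]t, +oo[ `]0%R, +oo[).
    apply: eq_Lq => u /=; rewrite in_itv/= andbT => u0.
    by rewrite GE// patchE mem_setE in_itv/= andbT; case: ifP; rewrite ?mule0.
  by move=> u /=; rewrite !in_itv/= !andbT; exact: lt_trans.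
split.
  apply: (@le_trans _ _ (A%:E * lq q (upper k (sample F)))); last first.
    by apply: lee_mulW; [exact/lq_ge0/upper_ge0|rewrite lerDl ltW].
  apply: HA => //; first exact: upper_ge0.
  move=> u u0; rewrite GE// /upper; case: ifPn => [ut|_]; last first.
    by case: ifP; rewrite ?mule0// mule_ge0// lee_fin ltW.
  rewrite ifT; last by apply: le_floor; rewrite ler_ln ?posrE// ltW.
  by apply: HF; rewrite ?expR_gt0// ln_floor_le1.
(* Now the incomplete interval is the first one, and the shift goes the other way. *)
apply: (@le_trans _ _ ((S * M)%:E * lq q (upper (k + 1) (sample F)))).
  apply: (HS 1%R) => //; [exact: upper_ge0|exact: upper_ge0|].
  move=> j; rewrite /upper lerD2r; case: ifP => _; last by rewrite mule0.
  by have [] := tame_sample j tF.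
apply: (@le_trans _ _ ((S * M * B)%:E *
    Lq q `]0%R, +oo[ (fun u => (u `^ (- recip q))%:E * G u))); last first.
  by apply: lee_mulW; [exact: Lq_ge0|rewrite lerDr ltW].
apply: lee_trans_mul (lexx _) _; first exact: mulr_gt0.
apply: HB => //; first exact: upper_ge0.
move=> u u0; rewrite /upper; case: ifPn => [uk|_]; last by rewrite mule_ge0 ?G0// lee_fin ltW.
rewrite GE// ifT; first by apply: HF; rewrite ?expR_gt0// distrC ln_floor_le1.
rewrite -ltr_ln ?posrE// (lt_le_trans (floorD1_gt _))//.
by rewrite (le_trans _ (floor_le (ln u)))// ler_int.
Qed.

End sampling.

(** * K-functionals of a compatible couple *)

Section Kfunctional.
Context {R : realType} {V : zmodType} (X0 X1 : V -> \bar R).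
Hypotheses (X0_ge0 : forall f, (0 <= X0 f)%E) (X1_ge0 : forall f, (0 <= X1 f)%E).
Implicit Types (s t u : R) (f g : V).
Local Open Scope ereal_scope.
Local Notation K := (Kfun X0 X1).

Lemma Kfun_le_decomp t f f0 f1 : f = (f0 + f1)%R -> K t f <= X0 f0 + t%:E * X1 f1.
Proof. by move=> ff; apply: ereal_inf_lbound; exists f0, f1. Qed.

Lemma decomp_ge0 t f0 f1 : (0 < t)%R -> 0 <= X0 f0 + t%:E * X1 f1.
Proof. by move=> t0; rewrite adde_ge0// mule_ge0// lee_fin ltW. Qed.

Lemma Kfun_ge0 t f : (0 < t)%R -> 0 <= K t f.
Proof.
by move=> t0; apply: le_ereal_inf_tmp => _ [f0 [f1 [_ ->]]]; exact: decomp_ge0.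
Qed.

Lemma Kfun_monotone s t f : (0 < s)%R -> (s <= t)%R -> K s f <= K t f.
Proof.
move=> s0 st; apply: le_ereal_inf_tmp => _ [f0 [f1 [ff ->]]].
apply: le_trans (Kfun_le_decomp s ff) _.
by apply: leeD => //; apply: lee_wpmul2r => //; rewrite lee_fin.
Qed.

(** The sharp factor is max(1, s/t); the symmetric majorant matches the logarithmic form of Potter's
    bounds. *)
Lemma Kfun_regular s t f : (0 < s)%R -> (0 < t)%R ->
  K s f <= (expR `|ln s - ln t|)%:E * K t f.
Proof.
move=> s0 t0; have e0 : (0 < expR `|ln s - ln t|)%R by exact: expR_gt0.
rewrite -lee_pdivrMl//; apply: le_ereal_inf_tmp => _ [f0 [f1 [ff ->]]].
rewrite lee_pdivrMl//; apply: le_trans (Kfun_le_decomp s ff) _.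
rewrite ge0_muleDr//; last by rewrite mule_ge0// lee_fin ltW.
apply: leeD.
  rewrite -[leLHS]mul1e; apply: lee_wpmul2r => //.
  by rewrite lee_fin -expR0 ler_expR normr_ge0.
rewrite muleA -EFinM; apply: lee_wpmul2r => //; rewrite lee_fin.
rewrite -{1}(lnK s0) -{2}(lnK t0) -expRD ler_expR -lerBlDr.
exact: ler_norm.
Qed.

Lemma le_Kfun_add (c t : R) f g z : (0 < c)%R -> (0 < t)%R ->
  (forall f0 f1 g0 g1, f = (f0 + f1)%R -> g = (g0 + g1)%R ->
    z <= c%:E * ((X0 f0 + t%:E * X1 f1) + (X0 g0 + t%:E * X1 g1))) ->
  z <= c%:E * (K t f + K t g).
Proof.
move=> c0 t0 H.
(* A real y can be moved across the inequality. For y = +oo the sum is +oo, because the infimum,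
   being nonnegative, is not -oo. *)
have inf_add (S : set (\bar R)) (w y : \bar R) : 0 <= y -> 0 <= ereal_inf S ->
    (forall x, S x -> w <= x + y) -> w <= ereal_inf S + y.
  case: y => [y| |] y0 S0 Sw //.
    by rewrite -leeBlDr//; apply: le_ereal_inf_tmp => x /Sw; rewrite leeBlDr.
  by rewrite addey ?leey// gt_eqF// (lt_le_trans _ S0)// ltNyr.
rewrite -lee_pdivrMl//; apply: (inf_add _ _ _); [exact: Kfun_ge0|exact: Kfun_ge0|].
move=> _ [f0 [f1 [ff ->]]]; rewrite addeC.
apply: (inf_add _ _ _); [exact: decomp_ge0|exact: Kfun_ge0|].
move=> _ [g0 [g1 [gg ->]]]; rewrite lee_pdivrMl// addeC; exact: H.
Qed.

End Kfunctional.

Lemma modulusN1 {R : realType} (k : scalar_kind) : modulus (-1 : scalars R k) = 1.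
Proof.
case: k; first exact: (@normrN1 R).
by rewrite /modulus (@normrN1 (scalars R ComplexScalars)).
Qed.

Section couple.
Context {R : realType} {k : scalar_kind} {V : topologicalLmodType (scalars R k)}.
Implicit Types (N : V -> \bar R) (s t u : R) (f g : V).
Local Open Scope ereal_scope.

Lemma quasi_norm0 N : quasi_norm N -> N 0%R = 0.
Proof. by move=> qN; apply/(qn_eq0 qN). Qed.

Lemma quasi_normN N f : quasi_norm N -> N (- f)%R = N f.
Proof.
move=> qN; rewrite -scaleN1r (qnZ qN).
by rewrite modulusN1 mul1e.
Qed.

Lemma quasi_normD N : quasi_norm N -> exists2 C : R, (0 < C)%R &
  forall f g, N (f + g)%R <= C%:E * (N f + N g).
Proof.
move=> qN; have [C HC] := qnD qN; exists (`|C| + 1)%R; first by rewrite ltr_wpDl.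
move=> f g; apply: le_trans (HC f g) _; apply: lee_mulW.
  by rewrite adde_ge0 ?(qn_ge0 qN).
by rewrite (le_trans (ler_norm _))// lerDl.
Qed.

Context (A0 A1 : V -> \bar R).
Hypothesis A_couple : compatible_couple A0 A1.
Local Notation K := (Kfun A0 A1).

Let qA0 : quasi_norm A0. Proof. by case: A_couple => _ []. Qed.
Let qA1 : quasi_norm A1. Proof. by case: A_couple => _ _ []. Qed.
Let A0_ge0 f : 0 <= A0 f. Proof. exact: (qn_ge0 qA0). Qed.
Let A1_ge0 f : 0 <= A1 f. Proof. exact: (qn_ge0 qA1). Qed.

Lemma KfunN t f : K t (- f)%R = K t f.
Proof.
have le g : K t (- g)%R <= K t g.
  apply: le_ereal_inf_tmp => _ [f0 [f1 [-> ->]]].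
  rewrite -[X in X + _](quasi_normN _ qA0) -[X in _ * X](quasi_normN _ qA1).
  by apply: Kfun_le_decomp; rewrite opprD.
by apply/eqP; rewrite eq_le le -{1}(opprK f) le.
Qed.

Lemma Kfun0 t : (0 < t)%R -> K t 0%R = 0.
Proof.
move=> t0; apply/eqP; rewrite eq_le (Kfun_ge0 A0_ge0 A1_ge0)// andbT.
apply: le_trans (Kfun_le_decomp _ _ t (esym (addr0 0%R))) _.
by rewrite !quasi_norm0// mule0 adde0.
Qed.

Lemma Kfun_le_A0 t f : K t f <= A0 f.
Proof.
apply: le_trans (Kfun_le_decomp _ _ t (esym (addr0 f))) _.
by rewrite (quasi_norm0 qA1) mule0 adde0.
Qed.

Lemma Kfun_le_A1 t f : K t f <= t%:E * A1 f.
Proof.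
apply: le_trans (Kfun_le_decomp _ _ t (esym (add0r f))) _.
by rewrite (quasi_norm0 qA0) add0e.
Qed.

Lemma KfunD : exists2 C : R, (0 < C)%R & forall t f g, (0 < t)%R ->
  K t (f + g)%R <= C%:E * (K t f + K t g).
Proof.
have [C C0 HC] := quasi_normD qA0; have [D D0 HD] := quasi_normD qA1.
exists (C + D)%R; first exact: addr_gt0.
move=> t f g t0; apply: le_Kfun_add => //; first exact: addr_gt0.
move=> f0 f1 g0 g1 -> ->; rewrite addrACA addeACA.
apply: le_trans (Kfun_le_decomp _ _ t erefl) _.
rewrite [leRHS]ge0_muleDr; last 2 first.
- by rewrite adde_ge0.
- by rewrite adde_ge0// mule_ge0// lee_fin ltW.
apply: leeD.
  by apply: le_trans (HC _ _) _; apply: lee_mulW; rewrite ?adde_ge0// lerDl ltW.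
rewrite -ge0_muleDr// muleCA; apply: lee_wpmul2l; first by rewrite lee_fin ltW.
by apply: le_trans (HD _ _) _; apply: lee_mulW; rewrite ?adde_ge0// lerDr ltW.
Qed.

(** If K vanishes, f has decompositions with both parts arbitrarily small, hence lies in every
    neighbourhood of 0, and the ambient space is Hausdorff. Nearly optimal decompositions need this
    when K(t,f) = 0. *)
Lemma Kfun_eq0 t f : (0 < t)%R -> K t f = 0 -> f = 0%R.
Proof.
move=> t0 Kf0; have [hausV _ _ emb0 emb1] := A_couple.
apply: hausV => B U fB U0.
exists f; split; first exact: nbhs_singleton.
have : nbhs (0 + 0 : V)%R U by rewrite addr0.
move=> /(@tvs.add_continuous V (0, 0)%R) [[U1 U2] /= [nU1 nU2] HU].
have [d1 d10 Hd1] := emb0 _ nU1; have [d2 d20 Hd2] := emb1 _ nU2.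
(* The first entry makes A0 f0 smaller than d1; the second, after division by t, makes A1 f1 smaller
   than d2. *)
have d0 : (0 < Num.min d1 (t * d2))%R by rewrite lt_min d10 mulr_gt0.
have : K t f < (Num.min d1 (t * d2))%:E by rewrite Kf0 lte_fin.
move=> /ereal_inf_lt[_ [f0 [f1 [-> ->]]] lt12].
apply: (HU (f0, f1)); split => /=.
  apply: Hd1; apply: le_lt_trans (lt_le_trans lt12 _); last first.
    by rewrite lee_fin ge_min lexx.
  by rewrite leeDl// mule_ge0// lee_fin ltW.
apply: Hd2; rewrite -[ltLHS]mul1e -(mulVf (lt0r_neq0 t0)) EFinM -muleA.
rewrite lte_pdivrMl// -EFinM; apply: le_lt_trans (lt_le_trans lt12 _); last first.
  by rewrite lee_fin ge_min lexx orbT.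
by rewrite leeDr.
Qed.

(** The definition of the infimum yields a decomposition only when K < 2K, that is, for K positive
    and finite. At +oo every decomposition serves, and K = 0 forces f = 0. *)
Lemma Kfun_near_min t f : (0 < t)%R -> exists f0 f1, f = (f0 + f1)%R /\
  A0 f0 + t%:E * A1 f1 <= 2%:E * K t f.
Proof.
move=> t0; have K0 := Kfun_ge0 A0_ge0 A1_ge0 f t0.
have [Ky|Ky] := eqVneq (K t f) +oo.
  by exists f, 0%R; rewrite addr0 Ky gt0_muley ?leey.
have [/(Kfun_eq0 t0)->|Kn0] := eqVneq (K t f) 0.
  exists 0%R, 0%R; rewrite addr0; split=> //.
  by rewrite (quasi_norm0 qA0) (quasi_norm0 qA1) Kfun0// !mule0 adde0.
have Kgt0 : 0 < K t f by rewrite lt_neqAle eq_sym Kn0.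
have : K t f < 2%:E * K t f.
  have Kf : K t f \is a fin_num by rewrite ge0_fin_numE// ltey.
  rewrite -(fineK Kf) -EFinM lte_fin mulr_natl mulr2n ltrDl.
  by rewrite fine_gt0// Kgt0 ltey.
move=> /ereal_inf_lt[_ [f0 [f1 [ff ->]]] /ltW le2].
by exists f0, f1.
Qed.

(** At a near minimum, K(u,f0) <= A0 f0 and K(u,f1) <= u A1 f1 give the bound for f0 when u >= t and
    for f1 when u <= t. The other two follow from f0 = f - f1 and f1 = f - f0, since (u/t) K(t,f) <=
    K(u,f) for u <= t and K(t,f) <= K(u,f) for u >= t. *)
Lemma Kfun_decomposition : exists2 C : R, (0 < C)%R & forall t f, (0 < t)%R ->
  exists f0 f1, f = (f0 + f1)%R /\ forall u, (0 < u)%R ->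
    ((u <= t)%R -> K u f0 <= C%:E * K u f /\
       K u f1 <= (C * expR (ln u - ln t))%:E * K t f) /\
    ((t <= u)%R -> K u f0 <= C%:E * K t f /\ K u f1 <= C%:E * K u f).
Proof.
have [C C0 HC] := KfunD.
(* The 2 is the loss of the near minimum; 3C is the quasi-triangle constant times 1 + 2, from the
   differences f - f1 and f - f0. *)
pose D := (2 + 3 * C)%R; have D0 : (0 < D)%R by rewrite addr_gt0// mulr_gt0.
have CD : (C * 3 <= D)%R by rewrite /D mulrC lerDr.
have D2 : (2 <= D)%R by rewrite lerDl mulr_ge0// ltW.
exists D => // t f t0; have [f0 [f1 [ff H]]] := Kfun_near_min f t0.
have K_ge0 u g : (0 < u)%R -> 0 <= K u g by exact: Kfun_ge0.
have tA0 : 0 <= t%:E * A1 f1 by rewrite mule_ge0// lee_fin ltW.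
have Kf0 u : (0 < u)%R -> K u f0 <= 2%:E * K t f.
  move=> u0; apply: le_trans (Kfun_le_A0 u f0) _.
  by apply: le_trans H; rewrite leeDl.
have Kf1 u : (0 < u)%R -> K u f1 <= (2 * expR (ln u - ln t))%:E * K t f.
  move=> u0; apply: le_trans (Kfun_le_A1 u f1) _.
  rewrite expRB !lnK ?posrE// mulrC EFinM -muleA -[X in X%:E * _](divfK (lt0r_neq0 t0)).
  rewrite EFinM -muleA; apply: lee_wpmul2l; first by rewrite lee_fin divr_ge0 ?ltW.
  by apply: le_trans H; rewrite leeDr.
have three (x y : \bar R) : x <= 2%:E * y -> 0 <= y ->
    C%:E * (y + x) <= D%:E * y.
  move=> xy y0; apply: (@le_trans _ _ ((C * 3)%:E * y)); last exact: lee_mulW.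
  rewrite EFinM -muleA; apply: lee_wpmul2l; first by rewrite lee_fin ltW.
  by rewrite (_ : 3%:E = 1 + 2%:E)// ge0_muleDl// mul1e leeD2l.
exists f0, f1; split=> // u u0; split=> [ut|tu].
  have Kf1u := Kf1 _ u0.
  split; last first.
    apply: le_trans Kf1u _; apply: lee_mulW; first exact: K_ge0.
    by rewrite ler_wpM2r// expR_ge0.
  have -> : f0 = (f + - f1)%R by rewrite ff addrK.
  apply: le_trans (HC _ _ _ u0) _; rewrite KfunN.
  apply: (three _ _); last exact: K_ge0.
  apply: le_trans Kf1u _; rewrite EFinM -muleA.
  apply: lee_wpmul2l => //.
  have -> : (expR (ln u - ln t) = (expR (ln t - ln u))^-1)%R.
    by rewrite -expRN opprB.
  rewrite lee_pdivrMl ?expR_gt0//.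
  apply: le_trans (Kfun_regular A0_ge0 A1_ge0 f t0 u0) _.
  by rewrite ger0_norm// subr_ge0 ler_ln.
have Kf0u := Kf0 _ u0; split.
  by apply: le_trans Kf0u _; apply: lee_mulW => //; exact: K_ge0.
have -> : f1 = (f + - f0)%R by rewrite ff addrC addKr.
apply: le_trans (HC _ _ _ u0) _; rewrite KfunN.
apply: (three _ _); last exact: K_ge0.
apply: le_trans Kf0u _; apply: lee_wpmul2l => //.
by apply: Kfun_monotone.
Qed.

End couple.

(** * Sampled interpolation quasi-norms and slow variation of tail norms *)

Section sampled_norms.
Context {R : realType}.
Implicit Types (u s t : R) (k : int) (phi F : R -> \bar R) (q r : \bar R) (a b w : R -> R).
Local Open Scope ereal_scope.

(** This is all that sampling uses of a K-functional, so it serves the couple (A0,A1) as well as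
    (X0,X1). *)
Definition regular phi := (forall t, (0 < t)%R -> 0 <= phi t) /\
  forall s t, (0 < s)%R -> (0 < t)%R -> phi s <= (expR `|ln s - ln t|)%:E * phi t.

Definition weighted (theta : R) b phi u : \bar R :=
  (u `^ (- theta) * b u)%:E * phi u.

Lemma sample_weighted theta b phi k :
  sample (weighted theta b phi) k =
  (expR (- theta * k%:~R) * b (expR k%:~R))%:E * phi (expR k%:~R).
Proof. by rewrite /sample /weighted powR_expR ?expR_gt0// expRK. Qed.

Lemma weighted_ge0 theta b phi u : potter b -> regular phi -> (0 < u)%R ->
  0 <= weighted theta b phi u.
Proof.
move=> [b0 _] [phi0 _] u0.
by rewrite mule_ge0 ?phi0// lee_fin mulr_ge0 ?powR_ge0// ltW// b0.
Qed.

Lemma sample_weighted_ge0 theta b phi k : potter b -> regular phi ->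
  0 <= sample (weighted theta b phi) k.
Proof. by move=> pb rphi; apply: weighted_ge0 => //; exact: expR_gt0. Qed.

(** The exponent collects |theta| from the power, 1 from Potter's bound for b and 1 from the
    regularity of phi. *)
Lemma weighted_le theta b : potter b -> exists2 C : R, (0 < C)%R &
  forall phi, regular phi -> forall s t, (0 < s)%R -> (0 < t)%R ->
  weighted theta b phi s <=
    (C * expR ((`|theta| + 2) * `|ln s - ln t|))%:E * weighted theta b phi t.
Proof.
move=> pb; have [C C0 HC] := potter_le pb ltr01; exists C => //.
move=> phi rphi s t s0 t0; have [phi0 Hphi] := rphi.
have b0 := pb.1; set d := `|ln s - ln t|%R.
have -> : (C * expR ((`|theta| + 2) * d) =
    expR (`|theta| * d) * (C * expR (1 * d)) * expR d :> R)%R.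
  by rewrite mulrCA -!mulrA -!expRD; congr (_ * expR _)%R; ring.
rewrite [leRHS]muleA -EFinM mulrAC EFinM -muleA /weighted.
have wt0 : (0 <= s `^ (- theta) * b s)%R by rewrite mulr_ge0 ?powR_ge0// ltW// b0.
apply: lee_pmul; rewrite ?lee_fin ?phi0//; last exact: Hphi.
rewrite mulrACA; apply: ler_pM; rewrite ?powR_ge0 ?(ltW (b0 _ _))//.
  rewrite !powR_expR// -expRD ler_expR -lerBlDr -mulrBr.
  by apply: le_trans (ler_norm _) _; rewrite normrM normrN.
exact: HC.
Qed.

Lemma tame_weighted theta b : potter b -> exists2 M : R, (0 < M)%R &
  forall phi, regular phi -> tame M (weighted theta b phi).
Proof.
move=> pb; have [C C0 HC] := weighted_le theta pb.
exists (C * expR (`|theta| + 2))%R; first by rewrite mulr_gt0// expR_gt0.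
move=> phi rphi; split; first by move=> u u0; exact: weighted_ge0.
move=> s t s0 t0 st; apply: le_trans (HC _ rphi _ _ s0 t0) _.
apply: lee_mulW; first exact: weighted_ge0.
by apply: ler_wpM2l; [exact: ltW|rewrite ler_expR ler_piMr// addr_ge0].
Qed.

Lemma interp_sample (theta : R) q b : 0 < q -> potter b ->
  exists2 C : R, (0 < C)%R & forall phi, regular phi ->
  ecomp C
    (Lq q `]0%R, +oo[ (fun u => (u `^ (- theta - recip q) * b u)%:E * phi u))
    (lq q (sample (weighted theta b phi))).
Proof.
move=> q0 pb; have [M M0 HM] := tame_weighted theta pb.
have [C C0 HC] := Lq_sample q0 M0; exists C => // phi rphi.
rewrite (@eq_Lq _ _ _ _ (fun u => (u `^ (- recip q))%:E * weighted theta b phi u)).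
  by apply: HC; exact: HM.
move=> u /=; rewrite in_itv/= andbT => u0.
by rewrite /weighted muleA -EFinM mulrA -powRD ?(gt_eqF u0) ?implybT// addrC.
Qed.

(** The inner norm over (0,t) is first replaced by its sampled form, which depends only on the
    e-adic interval of t; Potter's bound for b/a then permits sampling the outer norm. *)
Lemma interpL_sample (sigma : R) r b q a : 0 < r -> 0 < q -> potter b -> potter a ->
  exists2 C : R, (0 < C)%R & forall phi, regular phi ->
  ecomp C
    (Lq r `]0%R, +oo[ (fun t => (t `^ (- recip r) * (b t / a t))%:E *
       Lq q `]0%R, t[ (fun u => (u `^ (- sigma - recip q) * a u)%:E * phi u)))
    (lq r (fun k => (b (expR k%:~R) / a (expR k%:~R))%:E *
       lq q (lower k (sample (weighted sigma a phi))))).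
Proof.
move=> r0 q0 pb pa; have [M M0 HM] := tame_weighted sigma pa.
have [C C0 HC] := Lq_sample_lower q0 M0.
have pba := potter_div pb pa; have ba0 := pba.1.
have [D D0 HD] := potter_le pba ltr01.
have Q0 : (0 < D * expR 1 * C)%R by rewrite !mulr_gt0// expR_gt0.
have [A A0 HA] := Lq_le_lq r0 Q0; have [B B0 HB] := lq_le_Lq r0 Q0.
exists (A + B)%R; first exact: addr_gt0.
move=> phi rphi.
pose x k := (b (expR k%:~R) / a (expR k%:~R))%:E *
       lq q (lower k (sample (weighted sigma a phi))).
pose F t := (b t / a t)%:E *
  Lq q `]0%R, t[ (fun u => (u `^ (- recip q))%:E * weighted sigma a phi u).
have lx0 k : 0 <= lq q (lower k (sample (weighted sigma a phi))).
  by apply/lq_ge0/lower_ge0 => j; exact: sample_weighted_ge0.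
have x0 k : 0 <= x k by rewrite mule_ge0// lee_fin ltW// ba0 ?expR_gt0.
have F0 u : (0 < u)%R -> 0 <= F u.
  by move=> u0; rewrite mule_ge0 ?Lq_ge0// lee_fin ltW// ba0.
rewrite (@eq_Lq _ _ _ _ (fun u => (u `^ (- recip r))%:E * F u)); last first.
  move=> t /=; rewrite in_itv/= andbT => t0.
  rewrite /F muleA -EFinM; congr (_ * _); apply: eq_Lq => u /=.
  rewrite in_itv/= => /andP[u0 _].
  by rewrite /weighted muleA -EFinM mulrA -powRD ?(gt_eqF u0) ?implybT// addrC.
have QE (y : R) (z : \bar R) : (D * expR 1 * C)%:E * (y%:E * z) =
    (D * expR 1 * y)%:E * (C%:E * z).
  by rewrite muleA [RHS]muleA -!EFinM mulrAC.
have ln1 u : (`|ln u - ln (expR (Num.floor (ln u))%:~R)| <= 1)%R.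
  exact: ln_floor_le1.
have step s t : (0 < s)%R -> (0 < t)%R -> (`|ln s - ln t| <= 1)%R ->
    (b s / a s <= D * expR 1 * (b t / a t))%R.
  move=> s0 t0 st; apply: le_trans (HD _ _ s0 t0) _.
  apply: ler_wpM2r; first by rewrite ltW// ba0.
  by apply: ler_wpM2l; [exact: ltW|rewrite ler_expR mul1r].
split.
  apply: (@le_trans _ _ (A%:E * lq r x)); last first.
    by apply: lee_mulW; [exact: lq_ge0|rewrite lerDl ltW].
  apply: HA => // u u0; rewrite /x QE.
  apply: lee_pmul; [by have := ltW (ba0 _ u0); rewrite -lee_fin|exact: Lq_ge0| |].
    by rewrite lee_fin step// expR_gt0.
  by have [] := HC _ (HM _ rphi) _ u0.
apply: (@le_trans _ _ (B%:E * Lq r `]0%R, +oo[ (fun u => (u `^ (- recip r))%:E * F u))); last first.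
  by apply: lee_mulW; [exact: Lq_ge0|rewrite lerDr ltW].
apply: HB => // u u0; rewrite /F QE; apply: lee_pmul; [|exact: lx0| |].
- by rewrite lee_fin ltW// ba0 ?expR_gt0.
- by rewrite lee_fin step ?expR_gt0// distrC.
- by have [] := HC _ (HM _ rphi) _ u0.
Qed.

Definition upper_norm r w k : \bar R := lq r (upper k (fun j => (w (expR j%:~R))%:E)).

Lemma tail_sample r w : 0 < r -> potter w -> exists2 C : R, (0 < C)%R &
  forall t, (0 < t)%R ->
  ecomp C (tail_norm r w t) (upper_norm r w (Num.floor (ln t))).
Proof.
move=> r0 pw; have [D D0 HD] := potter_le pw ltr01.
have M0 : (0 < D * expR 1)%R by rewrite mulr_gt0// expR_gt0.
have [C C0 HC] := Lq_sample_upper r0 M0; exists C => // t t0.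
have tw : tame (D * expR 1) (fun u => (w u)%:E).
  split; first by move=> u u0; rewrite lee_fin ltW// pw.1.
  move=> s u s0 u0 su; rewrite -EFinM lee_fin; apply: le_trans (HD _ _ s0 u0) _.
  apply: ler_wpM2r; first by rewrite ltW// pw.1.
  by apply: ler_wpM2l; [exact: ltW|rewrite ler_expR mul1r].
rewrite /tail_norm (@eq_Lq _ _ _ _ (fun u => (u `^ (- recip r))%:E * (w u)%:E)).
  exact: (HC _ tw).
by move=> u _; rewrite EFinM.
Qed.

(** The tail from k is a translate of the tail from m, and translating w costs Potter's factor. So
    the tail norm inherits the slow variation of w whatever r is. *)
Lemma upper_norm_le r w (e : R) : 0 < r -> potter w -> (0 < e)%R ->
  exists2 C : R, (0 < C)%R & forall k m,
  upper_norm r w k <= (C * expR (e * `|(k - m)%:~R|))%:E * upper_norm r w m.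
Proof.
move=> r0 pw e0; have [S S0 HS] := lq_shift r0.
have [C C0 HC] := potter_eadic pw e0.
have w0 j : 0 <= (w (expR j%:~R))%:E by rewrite lee_fin ltW// pw.1 ?expR_gt0.
exists (S * C)%R; first exact: mulr_gt0.
move=> k m; rewrite -mulrA; apply: (HS (m - k)%R).
- by rewrite mulr_gt0// expR_gt0.
- exact: upper_ge0.
- exact: upper_ge0.
move=> j; rewrite /upper.
have -> : (m <= j + (m - k))%R = (k <= j)%R by rewrite addrCA lerDl subr_ge0.
case: ifP => _; last by rewrite mule0.
rewrite -EFinM lee_fin; apply: le_trans (HC (j + (m - k))%R j) _.
by rewrite (_ : j - (j + (m - k)) = k - m)%R//; ring.
Qed.

(** Finiteness at 1 spreads to every t through [upper_norm_le]. It is what makes [fine] faithful: at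
    +oo it would return 0, and the weight c1 would not be positive. *)
Lemma tail_norm_potter r w : 0 < r -> potter w -> tail_norm r w 1 < +oo ->
  (forall t, (0 < t)%R -> tail_norm r w t \is a fin_num) /\
  potter (fun t => fine (tail_norm r w t)).
Proof.
move=> r0 pw fin1; have [A A0 HA] := tail_sample r0 pw.
have w0 j : 0 <= (w (expR j%:~R))%:E by rewrite lee_fin ltW// pw.1 ?expR_gt0.
have un0 k : 0 <= upper_norm r w k by exact/lq_ge0/upper_ge0.
have un_fin k : upper_norm r w k \is a fin_num.
  rewrite ge0_fin_numE//; have [C C0 HC] := upper_norm_le r0 pw ltr01.
  apply: le_lt_trans (HC k (Num.floor (ln 1))) _.
  have [_ h] := HA _ (@ltr01 R).
  by apply: lte_mul_pinfty; rewrite ?lee_fin ?mulr_ge0 ?expR_ge0 ?(ltW C0)//;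
    apply: le_lt_trans h _; apply: lte_mul_pinfty; rewrite ?lee_fin ?(ltW A0).
have tn_fin t : (0 < t)%R -> tail_norm r w t \is a fin_num.
  move=> t0; rewrite ge0_fin_numE ?Lq_ge0//; have [h _] := HA _ t0.
  apply: le_lt_trans h _; apply: lte_mul_pinfty; rewrite ?lee_fin ?(ltW A0)//.
  by rewrite -ge0_fin_numE.
split=> //; apply: le_potter => [t t0|e e0].
  rewrite fine_gt0// -ge0_fin_numE ?Lq_ge0// tn_fin// andbT.
  have [_ h] := HA _ t0; rewrite lt_neqAle Lq_ge0 andbT eq_sym; apply/eqP => tn0.
  move: h; rewrite tn0 mule0; apply/negP; rewrite -ltNge.
  set k := Num.floor _.
  apply: (@lt_le_trans _ _ (upper k (fun j => (w (expR j%:~R))%:E) k)).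
    by rewrite /upper lexx lte_fin pw.1 ?expR_gt0.
  by apply: lq_ge => //; exact: upper_ge0.
have [C C0 HC] := upper_norm_le r0 pw e0.
exists (A * (C * expR e) * A)%R; first by rewrite !mulr_gt0// expR_gt0.
move=> s t s0 t0; rewrite -lee_fin EFinM !fineK ?tn_fin//.
have [h _] := HA _ s0; have [_ h'] := HA _ t0.
apply: le_trans h _; rewrite -!mulrA EFinM -muleA.
apply: lee_wpmul2l; first by rewrite lee_fin ltW.
apply: le_trans (HC _ (Num.floor (ln t))) _.
(* Rounding ln s and ln t down to integers enlarges their distance by at most 1, hence the factor
   [expR e]. *)
apply: (@le_trans _ _ ((C * (expR e * expR (e * `|ln s - ln t|)))%:E *
    upper_norm r w (Num.floor (ln t)))).
  apply: lee_mulW => //; apply: ler_wpM2l; first exact: ltW.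
  rewrite -expRD ler_expR.
  apply: (@le_trans _ _ (e * (1 + `|ln s - ln t|))%R); last by rewrite mulrDr mulr1.
  apply: ler_wpM2l; first exact: ltW.
  rewrite rmorphB/=; have /andP[h1 h2] := floor_itv (ln s).
  have /andP[h3 h4] := floor_itv (ln t); move: h2 h4; rewrite !rmorphD/= => h2 h4.
  have h5 := ler_norm (ln s - ln t); have h6 := ler_norm (ln t - ln s).
  rewrite distrC in h6.
  by rewrite ler_norml; apply/andP; split; lra.
have -> : (C * (expR e * (A * expR (e * `|ln s - ln t|))) =
    C * (expR e * expR (e * `|ln s - ln t|)) * A)%R by ring.
rewrite [X in _ <= X * _]EFinM -[leRHS]muleA; apply: lee_wpmul2l => //.
by rewrite lee_fin !mulr_ge0 ?expR_ge0// ltW.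
Qed.

End sampled_norms.

Lemma distz_split {R : realDomainType} (j i n : int) : j <= i -> i <= n ->
  `|(i - n)%:~R| + `|(j - i)%:~R| = `|(j - n)%:~R| :> R.
Proof.
move=> ji i_n; have jn := le_trans ji i_n.
rewrite !ler0_norm ?lerz0 ?subr_le0// !rmorphB/=; ring.
Qed.

(** * Holmstedt-type estimates *)

(** For y = +oo the right side is infinite through the positive term [x k] alone; for finite y this
    is homogeneity. *)
Lemma le_lq_mulr {R : realType} (q : \bar R) (x : int -> \bar R) (y : \bar R) k :
  (0 < q)%E -> (0 <= y)%E -> (forall j, 0 <= x j)%E -> (0 < x k)%E ->
  (lq q x * y <= lq q (fun j => x j * y))%E.
Proof.
move=> q0 y0 x0 xk.
have [->|yy] := eqVneq y +oo%E.
  apply: (@le_trans _ _ (x k * +oo)%E); first by rewrite [leRHS]gt0_muley ?leey.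
  by apply: (@lq_ge _ q (fun j => x j * +oo)%E) => // j; rewrite mule_ge0.
have yf : y \is a fin_num by rewrite ge0_fin_numE// ltey.
by under eq_fun do rewrite muleC; rewrite lqZ_fin// muleC.
Qed.

Section holmstedt.
Context {R : realType} {k : scalar_kind} {V : topologicalLmodType (scalars R k)}.
Context (A0 A1 : V -> \bar R) (theta0 theta1 : R) (q1 r1 r0 : \bar R).
Context (a1 b0 b1 : R -> R).
Hypotheses (A_couple : compatible_couple A0 A1)
  (theta0_gt0 : 0 < theta0) (theta01 : theta0 < theta1) (theta1_lt1 : theta1 < 1)
  (q1_gt0 : (0 < q1)%E) (r1_gt0 : (0 < r1)%E) (r0_gt0 : (0 < r0)%E)
  (pa1 : potter a1) (pb0 : potter b0) (pb1 : potter b1)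
  (tail_fin : (tail_norm r1 (fun s => (b1 s / a1 s)%R) 1 < +oo)%E).
Implicit Types (f : V) (i j m n : int).
Local Open Scope ereal_scope.

Let w s := (b1 s / a1 s)%R.
Definition tail_weight t : R := fine (tail_norm r1 w t).
Definition c1_weight t : R := (a1 t * tail_weight t)%R.
Definition rho_weight t : R := (t `^ (theta1 - theta0) * (b0 t / c1_weight t))%R.
Let X0 := interp A0 A1 theta0 r0 b0.
Let X1 := interpL A0 A1 theta1 r1 b1 q1 a1.
Let e n : R := expR n%:~R.
Let K f t := Kfun A0 A1 t f.
(** Three weightings of one K-functional: [G] is the integrand of X0, [H] the inner integrand of X1,
    and [S] the weak-type quantity that the norm of X1 controls. [I] is the X0 norm cut off at
    e^n. *)
Let G f := sample (weighted theta0 b0 (K f)).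
Let H f := sample (weighted theta1 a1 (K f)).
Let S f := sample (weighted theta1 c1_weight (K f)).
Let I f n := lq r0 (lower n (G f)).

Let pw : potter w. Proof. exact: (potter_div pb1 pa1). Qed.
Let e_gt0 n : (0 < e n)%R. Proof. exact: expR_gt0. Qed.

Lemma potter_tail_weight : potter tail_weight.
Proof. by have [] := tail_norm_potter r1_gt0 pw tail_fin. Qed.

Lemma potter_c1_weight : potter c1_weight.
Proof. exact: (potterM pa1 potter_tail_weight). Qed.

Let pT := potter_tail_weight.
Let pc1 := potter_c1_weight.

Lemma rho_weight_gt0 t : (0 < t)%R -> (0 < rho_weight t)%R.
Proof.
by move=> t0; rewrite mulr_gt0 ?powR_gt0// divr_gt0 ?pb0.1 ?pc1.1.
Qed.

Lemma regular_K f : regular (K f).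
Proof.
have [_ [q0 _] [q1' _] _ _] := A_couple.
split=> [t t0|s t s0 t0].
  by apply: Kfun_ge0 => //; [exact: qn_ge0 q0|exact: qn_ge0 q1'].
by apply: Kfun_regular => //; [exact: qn_ge0 q0|exact: qn_ge0 q1'].
Qed.

Let rK := regular_K.
Let K0 f n : 0 <= K f (e n). Proof. by apply: (rK f).1; exact: e_gt0. Qed.
Let G0 f n : 0 <= G f n. Proof. exact: sample_weighted_ge0. Qed.
Let H0 f n : 0 <= H f n. Proof. exact: sample_weighted_ge0. Qed.
Let S0 f n : 0 <= S f n. Proof. exact: sample_weighted_ge0. Qed.
Let I0 f n : 0 <= I f n. Proof. exact/lq_ge0/lower_ge0. Qed.
Let w0 n : 0 <= (w (e n))%:E. Proof. by rewrite lee_fin ltW// pw.1. Qed.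
Let un0 n : 0 <= upper_norm r1 w n. Proof. exact/lq_ge0/upper_ge0. Qed.
Let T0 n : (0 < tail_weight (e n))%R. Proof. exact: pT.1. Qed.

Lemma rho_weightE n :
  rho_weight (e n) = (expR ((theta1 - theta0) * n%:~R) * (b0 (e n) / c1_weight (e n)))%R.
Proof. by rewrite /rho_weight powR_expR// /e expRK. Qed.

(** This identity is the origin of [rho_weight]: it converts the weak-type weight of X1 into the
    weight of X0. *)
Lemma sample_rho_weight f n : G f n = (rho_weight (e n))%:E * S f n.
Proof.
rewrite /G /S !sample_weighted rho_weightE muleA -EFinM; congr (_%:E * _).
have c0 : c1_weight (e n) != 0%R by rewrite gt_eqF// pc1.1.
have -> : expR (- theta0 * n%:~R)%R =
    (expR ((theta1 - theta0) * n%:~R) * expR (- theta1 * n%:~R))%R :> R.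
  by rewrite -expRD; congr expR; ring.
by rewrite -/(e n); field.
Qed.

Lemma sample_tail_weight f n : S f n = (tail_weight (e n))%:E * H f n.
Proof.
rewrite /H /S !sample_weighted muleA -EFinM; congr (_%:E * _).
by rewrite /c1_weight /e; ring.
Qed.

Lemma tail_weight_upper : exists2 C : R, (0 < C)%R & forall n,
  ecomp C (tail_weight (e n))%:E (upper_norm r1 w n).
Proof.
have [C C0 HC] := tail_sample r1_gt0 pw; exists C => // n.
have := HC _ (e_gt0 n).
rewrite (_ : Num.floor (ln (e n)) = n); last by rewrite /e expRK intrKfloor.
have [fin _] := tail_norm_potter r1_gt0 pw tail_fin.
by rewrite /tail_weight fineK// fin.
Qed.

(* For i >= n the inner norm of X1 on (0, e^i) is at least its n-th term H f n;
   the outer norm over i >= n then contributes the factor tail_weight. *)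
Lemma S_le_X1 : exists2 C : R, (0 < C)%R & forall f n, S f n <= C%:E * X1 f.
Proof.
have [C C0 HC] := tail_weight_upper.
have [D D0 HD] := interpL_sample theta1 r1_gt0 q1_gt0 pb1 pa1.
exists (C * D)%R; first exact: mulr_gt0.
move=> f n; have [_ h] := HD _ (rK f); have [hT _] := HC n.
rewrite sample_tail_weight EFinM -muleA.
apply: (@le_trans _ _ (C%:E * (upper_norm r1 w n * H f n))).
  by rewrite [leRHS]muleA; apply: lee_wpmul2r.
apply: lee_wpmul2l; first by rewrite lee_fin ltW.
apply: le_trans h.
apply: le_trans (le_lq_mulr (k := n) _ _ _ _) _ => //.
- exact: upper_ge0.
- by rewrite /upper lexx lte_fin pw.1.
apply: le_lq => // i; first by apply: mule_ge0; [exact: upper_ge0|exact: H0].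
rewrite /upper; case: ifPn => [ni|_]; last first.
  rewrite mul0e; apply: mule_ge0; first exact: w0.
  by apply/lq_ge0/lower_ge0; exact: H0.
apply: lee_wpmul2l; first exact: w0.
rewrite [leLHS](_ : _ = lower i (H f) n); last by rewrite /lower ni.
by apply: lq_ge => //; exact: lower_ge0.
Qed.

Lemma G_add : exists2 C : R, (0 < C)%R & forall f g n,
  G (f + g)%R n <= C%:E * (G f n + G g n).
Proof.
have [C C0 HC] := KfunD A_couple; exists C => // f g n.
rewrite /G !sample_weighted.
have wt0 : (0 <= expR (- theta0 * n%:~R) * b0 (expR n%:~R))%R.
  by rewrite mulr_ge0 ?expR_ge0// ltW// pb0.1.
rewrite -ge0_muleDr; [|exact: K0|exact: K0].
rewrite muleCA; apply: lee_wpmul2l; first by rewrite lee_fin.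
by apply: HC; exact: e_gt0.
Qed.

(** The part f0 is immediate. For f1, [G f1 j] is rho(e^j) times a quantity bounded by the norm of
    X1, and rho(e^j) grows geometrically up to j = n, so the l_{r0} norm over j <= n is of the size
    of its last bound, rho(e^n) [X1 f1]. *)
Lemma holmstedt_lower : exists2 C : R, (0 < C)%R & forall f n,
  I f n <= C%:E * Kfun X0 X1 (rho_weight (e n)) f.
Proof.
have [CS CS0 HS] := S_le_X1.
have [CG CG0 HG] := G_add.
have [CX CX0 HX] := interp_sample theta0 r0_gt0 pb0.
have d0 : (0 < theta1 - theta0)%R by rewrite subr_gt0.
have [CR CR0 HR] := potter_growth (potter_div pb0 pc1) d0.
have d2 : (0 < (theta1 - theta0) / 2)%R by rewrite divr_gt0.
have [CL CL0 HL] := lq_geo r0_gt0 d2.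
have [CD CD0 HD] := lqD r0_gt0.
pose B := (CX + CL * (CR * CS))%R.
have B0 : (0 < B)%R by rewrite addr_gt0// !mulr_gt0.
exists (CG * CD * B)%R; first by rewrite !mulr_gt0.
move=> f n; rewrite -lee_pdivrMl ?mulr_gt0//.
apply: le_ereal_inf_tmp => _ [f0 [f1 [-> ->]]]; rewrite lee_pdivrMl ?mulr_gt0//.
have hI0 : I f0 n <= CX%:E * X0 f0.
  have [_ h] := HX _ (rK f0); apply: le_trans h.
  apply: le_lq => // [j|j]; first exact: lower_ge0.
  by rewrite /lower; case: ifP => // _; exact: G0.
have hI1 : I f1 n <= (CL * (CR * CS))%:E * ((rho_weight (e n))%:E * X1 f1).
  rewrite [leRHS]muleA -EFinM -[X in X%:E * _]mulrA; apply: (HL n).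
  - by apply: mulr_gt0; [exact: mulr_gt0|exact: rho_weight_gt0].
  - exact: Lq_ge0.
  - exact: lower_ge0.
  move=> j; rewrite /lower; case: ifPn => [jn|_]; last first.
    apply: mule_ge0; last exact: Lq_ge0.
    rewrite lee_fin; apply: mulr_ge0; last exact: expR_ge0.
    by apply: mulr_ge0; apply: ltW; [exact: mulr_gt0|exact: rho_weight_gt0].
  rewrite sample_rho_weight.
  apply: (@le_trans _ _ ((rho_weight (e j))%:E * (CS%:E * X1 f1))).
    by apply: lee_wpmul2l => //; rewrite lee_fin; exact/ltW/rho_weight_gt0.
  rewrite muleA -EFinM; apply: lee_mulW; first exact: Lq_ge0.
  have := HR _ _ jn; rewrite -!rho_weightE => hR.
  apply: le_trans (ler_wpM2r (ltW CS0) hR) _.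
  by rewrite le_eqVlt; apply/orP; left; apply/eqP; rewrite /e; ring.
apply: (@le_trans _ _ (CG%:E * (CD%:E * (I f0 n + I f1 n)))).
  apply: (@le_trans _ _ (lq r0 (fun j => CG%:E * (lower n (G f0) j + lower n (G f1) j)))).
    apply: le_lq => // [j|j]; first exact: lower_ge0.
    by rewrite /lower; case: ifP => // _; rewrite adde0 mule0.
  rewrite lqZ//; last by move=> j; rewrite adde_ge0// lower_ge0.
  apply: lee_wpmul2l; first by rewrite lee_fin ltW.
  by apply: HD => j; exact: lower_ge0.
rewrite muleA -EFinM (EFinM (CG * CD) B) -[leRHS]muleA.
apply: lee_wpmul2l; first by rewrite lee_fin mulr_ge0 ?ltW.
have RX0 : 0 <= (rho_weight (e n))%:E * X1 f1.
  by rewrite mule_ge0 ?Lq_ge0// lee_fin; exact/ltW/rho_weight_gt0.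
rewrite ge0_muleDr ?Lq_ge0//; apply: leeD.
  apply: le_trans hI0 _; apply: lee_mulW; first exact: Lq_ge0.
  by rewrite lerDl !mulr_ge0// ltW.
by apply: le_trans hI1 _; apply: lee_mulW => //; rewrite lerDr ltW.
Qed.

(* sup over u >= t of (u/t)^eps u^(-theta1) c1(u) K(u,f), at t = e^n. *)
Let U (eps : R) f n : \bar R := ereal_sup (range (fun j =>
  (expR (eps * `|(j - n)%:~R|))%:E * upper n (S f) j)).

Let U_ge eps f n j : (n <= j)%R ->
  S f j <= (expR (- eps * `|(j - n)%:~R|))%:E * U eps f n.
Proof.
move=> nj; rewrite mulNr expRN lee_pdivlMl ?expR_gt0//.
apply: ereal_sup_ubound; exists j => //.
by rewrite /upper nj.
Qed.

Let U0 eps f n : 0 <= U eps f n.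
Proof. by apply: le_trans (S0 f n) _; have := U_ge eps f (lexx n);
  rewrite subrr normr0 mulr0 expR0 mul1e. Qed.

(** Beyond n the K-functional of f0 stays below that of f at e^n while u^(-theta0) decays, as theta0
    > 0. The whole tail is then of the size of [G f n], one term of [I f n]. *)
Lemma truncated_X0_le (M : R) : (0 < M)%R ->
  exists2 C : R, (0 < C)%R & forall f f0 n,
  (forall j, (j <= n)%R -> K f0 (e j) <= M%:E * K f (e j)) ->
  (forall j, (n <= j)%R -> K f0 (e j) <= M%:E * K f (e n)) ->
  X0 f0 <= C%:E * I f n.
Proof.
move=> M0; have [CX CX0 HX] := interp_sample theta0 r0_gt0 pb0.
have [CB CB0 HB] := potter_decay pb0 theta0_gt0.
have d2 : (0 < theta0 / 2)%R by rewrite divr_gt0.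
have [CL CL0 HL] := lq_geo r0_gt0 d2.
have [CD CD0 HD] := lqD r0_gt0.
exists (CX * (M * (CD * (1 + CL * CB))))%R.
  by rewrite !mulr_gt0// addr_gt0// mulr_gt0.
move=> f f0 n le_lo le_hi; have [h _] := HX _ (rK f0).
apply: le_trans h _; rewrite EFinM -muleA.
apply: lee_wpmul2l; first by rewrite lee_fin ltW.
pose y j := (CB * expR (- (theta0 / 2) * `|(j - n)%:~R|))%:E * G f n.
have y0 j : 0 <= y j by rewrite mule_ge0// lee_fin mulr_ge0 ?expR_ge0// ltW.
have l0 : forall j, 0 <= lower n (G f) j by exact: lower_ge0.
have wt0 j : (0 <= expR (- theta0 * j%:~R) * b0 (e j))%R.
  by rewrite mulr_ge0 ?expR_ge0// ltW// pb0.1.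
apply: (@le_trans _ _ (lq r0 (fun j => M%:E * (lower n (G f) j + y j)))).
  apply: le_lq => // j; first exact: G0.
  have [jn|/ltW nj] := leP j n.
    apply: (@le_trans _ _ (M%:E * G f j)).
      rewrite /G !sample_weighted [leRHS]muleCA; apply: lee_wpmul2l; last exact: le_lo.
      by rewrite lee_fin.
    apply: lee_wpmul2l; first by rewrite lee_fin ltW.
    by rewrite /lower jn leeDl.
  apply: (@le_trans _ _ (M%:E * y j)); last first.
    by apply: lee_wpmul2l; rewrite ?lee_fin ?(ltW M0)// leeDr.
  rewrite /y /G !sample_weighted [X in _ <= _ * X]muleA -EFinM [leRHS]muleCA.
  apply: lee_pmul; [by rewrite lee_fin|exact: K0| |exact: le_hi].
  by rewrite lee_fin; exact: HB.
rewrite lqZ//; last by move=> j; rewrite adde_ge0.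
rewrite EFinM -muleA; apply: lee_wpmul2l; first by rewrite lee_fin ltW.
apply: le_trans (HD _ _ l0 y0) _; rewrite EFinM -muleA.
apply: lee_wpmul2l; first by rewrite lee_fin ltW.
rewrite EFinD ge0_muleDl ?lee_fin ?mulr_ge0 ?(ltW CL0) ?(ltW CB0)// mul1e.
apply: leeD => //; apply: (@le_trans _ _ ((CL * CB)%:E * G f n)).
  by apply: (HL n).
apply: lee_wpmul2l; first by rewrite lee_fin mulr_ge0 ?ltW.
rewrite [leLHS](_ : _ = lower n (G f) n); last by rewrite /lower lexx.
exact: lq_ge.
Qed.

Let H_U eps f n : H f n <= ((tail_weight (e n))^-1)%:E * U eps f n.
Proof.
rewrite lee_pdivlMl// -sample_tail_weight.
by have := U_ge eps f (lexx n); rewrite subrr normr0 mulr0 expR0 mul1e.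
Qed.

(* The geometric decay on both sides of n comes from theta1 < 1 for j <= n, and
   for n <= j from the factor (u/t)^eps in U, which also pays for replacing
   tail_weight (e j) by tail_weight (e n). *)
Lemma sample_remainder_le (eps M : R) : (0 < eps)%R -> (0 < M)%R ->
  exists kap C : R, [/\ (0 < kap)%R, (0 < C)%R & forall f f1 n,
  (forall j, (j <= n)%R -> K f1 (e j) <= (M * expR (j%:~R - n%:~R))%:E * K f (e n)) ->
  (forall j, (n <= j)%R -> K f1 (e j) <= M%:E * K f (e j)) -> forall j,
  H f1 j <= (C / tail_weight (e n) * expR (- kap * `|(j - n)%:~R|))%:E * U eps f n].
Proof.
move=> eps0 M0.
have d1 : (0 < 1 - theta1)%R by rewrite subr_gt0.
have [CA CA0 HA] := potter_growth pa1 d1.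
have e2 : (0 < eps / 2)%R by rewrite divr_gt0.
have [CT CT0 HT] := potter_eadic (potterV pT) e2.
(* Potter's bounds have spent half of 1 - theta1 to the left of n and half of eps to the right; the
   smaller remainder serves on both sides. *)
pose kap := Num.min ((1 - theta1) / 2)%R (eps / 2)%R.
have kap0 : (0 < kap)%R by rewrite lt_min e2 divr_gt0.
exists kap, (M * (CA + CT))%R; split=> //; first by rewrite mulr_gt0// addr_gt0.
move=> f f1 n le_lo le_hi j.
have Ti0 : (0 < (tail_weight (e n))^-1)%R by rewrite invr_gt0.
have wt0 i : (0 <= expR (- theta1 * i%:~R) * a1 (e i))%R.
  by rewrite mulr_ge0 ?expR_ge0// ltW// pa1.1.
rewrite -!mulrA EFinM -muleA (mulrA (CA + CT)%R).
have [jn|/ltW nj] := leP j n.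
  apply: (@le_trans _ _ (M%:E * ((expR (- theta1 * j%:~R) * a1 (e j))%:E *
      ((expR (j%:~R - n%:~R))%:E * K f (e n))))).
    rewrite /H sample_weighted [leRHS]muleCA; apply: lee_wpmul2l; first by rewrite lee_fin.
    by rewrite muleA -EFinM; exact: le_lo.
  apply: lee_wpmul2l; first by rewrite lee_fin ltW.
  apply: (@le_trans _ _
    ((CA * expR (- ((1 - theta1) / 2) * `|(j - n)%:~R|))%:E * H f n)).
    rewrite /H sample_weighted.
    rewrite !muleA -!EFinM; apply: lee_mulW; first exact: K0.
    have := ler_wpM2r (expR_ge0 (- n%:~R)) (HA _ _ jn).
    rewrite -/(e n) -/(e j).
    have -> : (expR ((1 - theta1) * j%:~R) * a1 (e j) * expR (- n%:~R) =
        expR (- theta1 * j%:~R) * a1 (e j) * expR (j%:~R - n%:~R))%R.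
      rewrite mulrAC -expRD [RHS]mulrAC -expRD; by congr (expR _ * _)%R; ring.
    move=> /le_trans; apply.
    have -> : (expR (- theta1 * n%:~R) = expR ((1 - theta1) * n%:~R) * expR (- n%:~R) :> R)%R.
      by rewrite -expRD; congr expR; ring.
    by rewrite le_eqVlt; apply/orP; left; apply/eqP; ring.
  apply: (@le_trans _ _ ((CA * expR (- ((1 - theta1) / 2) * `|(j - n)%:~R|))%:E *
     (((tail_weight (e n))^-1)%:E * U eps f n))).
    by apply: lee_wpmul2l; [rewrite lee_fin mulr_ge0 ?expR_ge0 ?(ltW CA0)|exact: H_U].
  rewrite muleA -EFinM; apply: lee_mulW => //.
  rewrite mulrAC; apply: ler_pM; rewrite ?mulr_ge0 ?expR_ge0 ?(ltW CA0) ?(ltW Ti0)//.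
    by apply: ler_wpM2r; [exact: ltW|rewrite lerDl ltW].
  by rewrite ler_expR !mulNr lerN2; apply: ler_wpM2r => //; rewrite ge_min lexx.
apply: (@le_trans _ _ (M%:E * H f j)).
  rewrite /H !sample_weighted [leRHS]muleCA; apply: lee_wpmul2l; last exact: le_hi.
  by rewrite lee_fin.
apply: lee_wpmul2l; first by rewrite lee_fin ltW.
apply: (@le_trans _ _ (((tail_weight (e j))^-1)%:E *
    ((expR (- eps * `|(j - n)%:~R|))%:E * U eps f n))).
  by rewrite lee_pdivlMl// -sample_tail_weight; exact: U_ge.
rewrite muleA -EFinM; apply: lee_mulW => //.
apply: le_trans (ler_wpM2r (expR_ge0 _) (HT n j)) _.
rewrite -/(e n) [leLHS](_ : _ =
    CT / tail_weight (e n) * expR (- (eps / 2) * `|(j - n)%:~R|))%R; last first.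
  have -> : (expR (- (eps / 2) * `|(j - n)%:~R|) =
      expR (eps / 2 * `|(j - n)%:~R|) * expR (- eps * `|(j - n)%:~R|) :> R)%R.
    by rewrite -expRD; congr expR; field.
  by ring.
apply: ler_pM; rewrite ?mulr_ge0 ?expR_ge0 ?(ltW CT0) ?(ltW Ti0)//.
  by apply: ler_wpM2r; [exact: ltW|rewrite lerDr ltW].
rewrite ler_expR.
by rewrite !mulNr lerN2; apply: ler_wpM2r => //; rewrite ge_min lexx orbT.
Qed.

(** For i >= n the inner norm on (0,e^i) is bounded by its peak at n, and the outer norm of w over
    these i is the tail weight, which cancels the one in the denominator. For i < n the inner norm
    decays like e^(-kap (n - i)), twice the rate at which w may vary, and the outer norm is
    geometric. *)
Lemma truncated_X1_le (eps M : R) : (0 < eps)%R -> (0 < M)%R ->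
  exists2 C : R, (0 < C)%R & forall f f1 n,
  (forall j, (j <= n)%R -> K f1 (e j) <= (M * expR (j%:~R - n%:~R))%:E * K f (e n)) ->
  (forall j, (n <= j)%R -> K f1 (e j) <= M%:E * K f (e j)) ->
  X1 f1 <= C%:E * U eps f n.
Proof.
move=> eps0 M0; have [kap [C3 [kap0 C30 H3]]] := sample_remainder_le eps0 M0.
have [CI CI0 HI] := interpL_sample theta1 r1_gt0 q1_gt0 pb1 pa1.
have [GQ GQ0 HGQ] := lq_geo q1_gt0 kap0.
have k2 : (0 < kap / 2)%R by rewrite divr_gt0.
have [GR GR0 HGR] := lq_geo r1_gt0 k2.
have [CD CD0 HD] := lqD r1_gt0.
have [CW CW0 HW] := potter_eadic pw k2.
have [CT CT0 HT] := tail_weight_upper.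
pose B := (GQ * C3)%R; have B0 : (0 < B)%R by exact: mulr_gt0.
pose D := (B * CW * CT)%R; have D0 : (0 < D)%R by rewrite !mulr_gt0.
exists (CI * (CD * (B * CT + GR * D)))%R.
  by rewrite !mulr_gt0// addr_gt0// mulr_gt0.
move=> f f1 n le_lo le_hi.
(* Below, U is pulled out of an l_q norm as a factor, which requires it to be finite. *)
have [Uy|Uy] := eqVneq (U eps f n) +oo.
  by rewrite Uy gt0_muley ?leey// lte_fin !mulr_gt0// addr_gt0// mulr_gt0.
have Uf : U eps f n \is a fin_num by rewrite ge0_fin_numE// ltey.
have [h _] := HI _ (rK f1).
apply: le_trans h _; rewrite EFinM -muleA.
apply: lee_wpmul2l; first by rewrite lee_fin ltW.
have hH := H3 _ _ _ le_lo le_hi.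
set t := tail_weight (e n) in hH *; have t0 : (0 < t)%R by exact: T0.
have C3t : (0 < C3 / t)%R by rewrite divr_gt0.
pose z i := (B / t)%:E * U eps f n * upper n (fun j => (w (e j))%:E) i.
pose y i := (D * expR (- (kap / 2) * `|(i - n)%:~R|))%:E * U eps f n.
have c0 : 0 <= (B / t)%:E * U eps f n by rewrite mule_ge0// lee_fin divr_ge0 ?ltW.
have z0 i : 0 <= z i by apply: mule_ge0 => //; exact: upper_ge0.
have y0 i : 0 <= y i by rewrite mule_ge0// lee_fin mulr_ge0 ?expR_ge0// ltW.
have lH0 i : 0 <= lq q1 (lower i (H f1)) by exact/lq_ge0/lower_ge0.
(* w(e^n) is a single term of the tail norm that defines t. *)
have Wt : (w (e n) <= CT * t)%R.
  rewrite -lee_fin EFinM; apply: (@le_trans _ _ (upper_norm r1 w n)).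
    rewrite [leLHS](_ : _ = upper n (fun j => (w (e j))%:E) n).
      by apply: lq_ge => //; exact: upper_ge0.
    by rewrite /upper lexx.
  by have [] := HT n.
apply: (@le_trans _ _ (lq r1 (fun i => z i + y i))).
  apply: le_lq => // i; first by apply: mule_ge0; [exact: w0|exact: lH0].
  have [ni|] := leP n i.
    apply: (@le_trans _ _ (z i)); last by rewrite leeDl.
    rewrite /z /upper ni [leRHS]muleC; apply: lee_wpmul2l; first exact: w0.
    rewrite /B -mulrA; apply: (HGQ n); [exact: C3t|exact: U0| |].
      by apply: lower_ge0; exact: H0.
    move=> j; rewrite /lower; case: ifP => _; first exact: hH.
    by rewrite mule_ge0// lee_fin mulr_ge0 ?expR_ge0// ltW.
  move=> i_n; apply: (@le_trans _ _ (y i)); last by rewrite leeDr.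
  (* For j <= i < n the distance from j to n splits at i, so the kernel factors: the part centred at
     i is summed, the part in i - n remains as decay. *)
  have lqi : lq q1 (lower i (H f1)) <=
      (GQ * (C3 / t * expR (- kap * `|(i - n)%:~R|)))%:E * U eps f n.
    apply: (HGQ i); [by rewrite mulr_gt0// expR_gt0|exact: U0| |].
      by apply: lower_ge0; exact: H0.
    move=> j; rewrite /lower; case: ifPn => ji; last first.
      rewrite mule_ge0// lee_fin; apply: mulr_ge0; last exact: expR_ge0.
      by apply: mulr_ge0; [exact: ltW|exact: expR_ge0].
    apply: le_trans (hH j) _; apply: lee_mulW => //.
    rewrite -[leRHS]mulrA; apply: ler_wpM2l; first exact: ltW.
    rewrite -expRD ler_expR -mulrDr !mulNr lerN2; apply: ler_wpM2l; first exact: ltW.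
    by rewrite distz_split// ltW.
  apply: (@le_trans _ _ ((w (e i))%:E *
      ((GQ * (C3 / t * expR (- kap * `|(i - n)%:~R|)))%:E * U eps f n))).
    by apply: lee_wpmul2l; [exact: w0|exact: lqi].
  rewrite muleA -EFinM; apply: lee_mulW => //.
  have h1 : (w (e i) <= CW * expR (kap / 2 * `|(i - n)%:~R|) * (CT * t))%R.
    apply: le_trans (HW n i) _; apply: ler_wpM2l => //.
    by rewrite mulr_ge0 ?expR_ge0// ltW.
  have h2 : (0 <= GQ * (C3 / t * expR (- kap * `|(i - n)%:~R|)))%R.
    by apply: mulr_ge0; [exact: ltW|apply: mulr_ge0; [exact: ltW|exact: expR_ge0]].
  apply: le_trans (ler_wpM2r h2 h1) _.
  have -> : (expR (- (kap / 2) * `|(i - n)%:~R|) =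
     expR (kap / 2 * `|(i - n)%:~R|) * expR (- kap * `|(i - n)%:~R|) :> R)%R.
    by rewrite -expRD; congr expR; field.
  have tn0 : t != 0%R by rewrite gt_eqF.
  by rewrite le_eqVlt; apply/orP; left; apply/eqP; rewrite /D /B; field.
apply: le_trans (HD _ _ z0 y0) _; rewrite EFinM -muleA.
apply: lee_wpmul2l; first by rewrite lee_fin ltW.
rewrite EFinD ge0_muleDl; last 2 first.
- by rewrite lee_fin; apply: mulr_ge0; exact: ltW.
- by rewrite lee_fin; apply: mulr_ge0; exact: ltW.
apply: leeD; last by apply: (HGR n).
rewrite lqZ_fin//; last 2 first.
- by rewrite fin_numM.
- exact: upper_ge0.
have [_ hT] := HT n.
apply: (@le_trans _ _ ((B / t)%:E * U eps f n * (CT%:E * t%:E))).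
  exact: lee_wpmul2l.
rewrite muleAC -!EFinM; apply: lee_mulW => //.
have tn0 : t != 0%R by rewrite gt_eqF.
by rewrite le_eqVlt; apply/orP; left; apply/eqP; field.
Qed.

Lemma holmstedt_upper (eps : R) : (0 < eps)%R ->
  exists2 C : R, (0 < C)%R & forall f n,
  Kfun X0 X1 (rho_weight (e n)) f <=
    C%:E * (I f n + (rho_weight (e n))%:E * U eps f n).
Proof.
move=> eps0; have [C C0 HC] := Kfun_decomposition A_couple.
have [C1 C10 H1] := truncated_X0_le C0; have [C2 C20 H2] := truncated_X1_le eps0 C0.
exists (C1 + C2)%R; first exact: addr_gt0.
move=> f n; have [f0 [f1 [ff dec]]] := HC _ f (e_gt0 n).
have rho0 := ltW (rho_weight_gt0 (e_gt0 n)).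
apply: le_trans (Kfun_le_decomp _ _ _ ff) _.
have le_e i j : (i <= j)%R -> (e i <= e j)%R by rewrite ler_expR ler_int.
rewrite ge0_muleDr//; last by rewrite mule_ge0.
apply: leeD.
  apply: (@le_trans _ _ (C1%:E * I f n)); last by apply: lee_mulW; rewrite // lerDl ltW.
  apply: H1 => j ij; have [lo hi] := dec _ (e_gt0 j).
    by have [] := lo (le_e _ _ ij).
  by have [] := hi (le_e _ _ ij).
rewrite muleCA; apply: lee_wpmul2l; first by rewrite lee_fin.
apply: (@le_trans _ _ (C2%:E * U eps f n)); last by apply: lee_mulW; rewrite // lerDr ltW.
apply: H2 => j ij; have [lo hi] := dec _ (e_gt0 j).
  by have [_] := lo (le_e _ _ ij); rewrite /e !expRK.
by have [] := hi (le_e _ _ ij).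
Qed.

End holmstedt.

(** * Reiteration *)

Section change_of_variables.
Context {R : realType}.
Variables (delta : R) (v : R -> R).
Hypotheses (delta0 : 0 < delta) (pv : potter v).
Let rho t : R := t `^ delta * v t.
Implicit Types (j n : int).

Lemma ln_power_potter t : 0 < t -> ln (rho t) = delta * ln t + ln (v t).
Proof. by move=> t0; rewrite lnM ?posrE ?powR_gt0 ?pv.1// ln_powR. Qed.

Lemma ln_power_potter_le : exists M D : R, 0 < D /\ forall s t, 0 < s -> 0 < t ->
  `|ln (rho s) - ln (rho t)| <= M + D * `|ln s - ln t|.
Proof.
have [M HM] := pv.2 _ (@ltr01 R); exists M, (delta + 1); split; first exact: addr_gt0.
move=> s t s0 t0; rewrite !ln_power_potter//.
have -> : delta * ln s + ln (v s) - (delta * ln t + ln (v t)) =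
  delta * (ln s - ln t) + (ln (v s) - ln (v t)) by ring.
apply: le_trans (ler_normD _ _) _; rewrite normrM (gtr0_norm delta0).
by have := HM _ _ s0 t0; lra.
Qed.

(** With exponent delta/2, v cancels at most half of delta |ln s - ln t| up to a constant. Together
    with the upper bound this makes ln rho a quasi-isometry in ln t, although rho need not be
    monotone or continuous. *)
Lemma ln_power_potter_ge : exists M D : R, 0 < D /\ forall s t, 0 < s -> 0 < t ->
  `|ln s - ln t| <= M + D * `|ln (rho s) - ln (rho t)|.
Proof.
have d2 : 0 < delta / 2 by rewrite divr_gt0.
have [M HM] := pv.2 _ d2; exists ((delta / 2)^-1 * M), (delta / 2)^-1.
rewrite invr_gt0; split=> // s t s0 t0; rewrite -mulrDr -ler_pdivrMl ?invr_gt0// invrK.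
rewrite !ln_power_potter//.
have := HM _ _ s0 t0.
have := ler_normB (delta * ln s + ln (v s) - (delta * ln t + ln (v t)))
  (ln (v s) - ln (v t)).
have -> : delta * ln s + ln (v s) - (delta * ln t + ln (v t)) - (ln (v s) - ln (v t)) =
  delta * (ln s - ln t) by ring.
rewrite normrM (gtr0_norm delta0); lra.
Qed.

(** This replaces the intermediate value theorem: ln rho changes by a bounded amount from e^n to
    e^(n+1), so at a crossing of level j it is close to j. *)
Lemma discrete_ivt (P : pred int) (N : nat) : P N%:Z -> ~~ P (- N%:Z) ->
  exists n : int, ~~ P n /\ P (n + 1).
Proof.
move=> PN PNN; pose Q (m : nat) := P (m%:Z - N%:Z).
have exQ : exists m, Q m by exists (N + N)%N; rewrite /Q PoszD addrK.
have := ex_minnP exQ; case=> [[|m]]; first by rewrite /Q sub0r (negbTE PNN).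
move=> Qm minm; exists (m%:Z - N%:Z); split.
  by apply/negP => /minm; rewrite ltnn.
by move: Qm; rewrite /Q -addn1 PoszD addrAC.
Qed.

Lemma power_potter_onto : exists M : R, forall j, exists n,
  `|ln (rho (expR n%:~R)) - j%:~R| <= M.
Proof.
have [M [D [D0 HMD]]] := ln_power_potter_le; exists (M + D) => j.
have d2 : 0 < delta / 2 by rewrite divr_gt0.
have [M' HM'] := pv.2 _ d2.
(* By Potter with exponent delta/2, ln rho(e^N) is at least (delta/2) N - |M'| - |ln (v 1)|, and
   symmetrically at -N; c adds |j|, so level j is crossed between -N and N. *)
pose c := `|M'| + `|ln (v 1)| + `|j%:~R|.
pose N := Num.bound ((delta / 2)^-1 * c).
have c0 : 0 <= c by rewrite !addr_ge0.
have cN : c < delta / 2 * N%:R.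
  rewrite -ltr_pdivrMl//; have := @archi_boundP R ((delta / 2)^-1 * c).
  by apply; rewrite mulr_ge0// invr_ge0 ltW.
have e0 n : 0 < expR n%:~R :> R by exact: expR_gt0.
have [||n [nlt nle]] := @discrete_ivt (fun n => j%:~R <= ln (rho (expR n%:~R))) N.
- rewrite ln_power_potter// expRK.
  have := HM' _ _ (e0 N%:Z) (@ltr01 R); rewrite ln1 subr0 expRK.
  rewrite [X in _ * X]ger0_norm ?ler0z// ler_norml => /andP[h _].
  have := ler_norm (j%:~R : R); have := ler_norm M'; have := ler_norm (- ln (v 1)).
  rewrite normrN; move: cN h; rewrite /c -!pmulrn; lra.
- rewrite -ltNge ln_power_potter// expRK.
  have := HM' _ _ (e0 (- N%:Z)) (@ltr01 R); rewrite ln1 subr0 expRK.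
  rewrite [X in _ * X]ler0_norm ?lerz0 ?oppr_le0// ler_norml => /andP[_ h].
  have := ler_norm (- j%:~R : R); have := ler_norm M'; have := ler_norm (ln (v 1)).
  rewrite normrN; move: cN h; rewrite /c !rmorphN/= -!pmulrn; lra.
exists n; move: nlt; rewrite -ltNge => nlt.
have := HMD _ _ (e0 (n + 1)) (e0 n).
rewrite !expRK rmorphD/= addrAC subrr add0r normr1 mulr1 => /(le_trans (ler_norm _)).
rewrite -rmorphD/=; move: nle nlt => /= nle nlt h.
by rewrite ltr0_norm; lra.
Qed.

(** [sigma] rounds ln rho(e^n) to an integer and [tau] is a coarse inverse of it. Each serves in one
    direction as the centre map of the kernel, so rho need not be injective. *)
Lemma lq_change q (N M : R) : (0 < q)%E -> 0 < N -> 0 < M ->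
  exists2 C : R, 0 < C & forall F : R -> \bar R,
  (forall t, 0 < t -> (0 <= F t)%E) ->
  (forall s t, 0 < s -> 0 < t ->
     (F s <= (M * expR (N * `|ln s - ln t|))%:E * F t)%E) ->
  ecomp C (lq q (sample F)) (lq q (fun n => F (rho (expR n%:~R)))).
Proof.
move=> q0 N0 M0; have [M1 ex_tau] := power_potter_onto.
have [tau Htau] := choice ex_tau.
have [M2 [D2 [D20 H2]]] := ln_power_potter_ge.
have e0 n : 0 < expR n%:~R :> R by exact: expR_gt0.
have rho0 t : 0 < t -> 0 < rho t by move=> t0; rewrite mulr_gt0 ?powR_gt0 ?pv.1.
pose sigma n := Num.floor (ln (rho (expR n%:~R))).
have Hsigma n : `|ln (rho (expR n%:~R)) - (sigma n)%:~R| <= 1.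
  by rewrite -[X in _ - X]expRK; exact: ln_floor_le1.
(* Each constant is the variation of F divided by the kernel at the chosen index: |j - sigma (tau
   j)| is at most |M1| + 1, and |k - tau (sigma k)| at most |M2| + D2 (|M1| + 1). *)
pose A := M * expR (N * `|M1|) * expR (`|M1| + 1).
pose B := M * expR N * expR (`|M2| + D2 * (`|M1| + 1)).
have A0 : 0 < A by rewrite !mulr_gt0// expR_gt0.
have B0 : 0 < B by rewrite !mulr_gt0// expR_gt0.
have [CA CA0 HA] := lq_hardy q0 A0 (@ltr01 R).
have [CB CB0 HB] := lq_hardy q0 B0 (@ltr01 R).
exists (CA + CB); first exact: addr_gt0.
move=> F F0 HF.
have x0 k : (0 <= sample F k)%E by rewrite F0.
have y0 k : (0 <= F (rho (expR k%:~R)))%E by rewrite F0// rho0.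
split.
  apply: (@le_trans _ _ (CA%:E * lq q (fun n => F (rho (expR n%:~R))))%E); last first.
    by apply: lee_mulW; [exact: lq_ge0|rewrite lerDl ltW].
  apply: (HA sigma) => // j; apply: le_ereal_sup_tmp.
  exists ((A * expR (-1 * `|(j - sigma (tau j))%:~R|))%:E *
     F (rho (expR (tau j)%:~R)))%E; first by exists (tau j).
  apply: le_trans (HF _ _ (e0 j) (rho0 _ (e0 (tau j)))) _.
  apply: lee_mulW; first by rewrite F0// rho0.
  rewrite -!mulrA; apply: ler_wpM2l; first exact: ltW.
  have h1 := le_trans (Htau j) (ler_norm M1); rewrite distrC in h1.
  have h2 := Hsigma (tau j).
  have h3 : `|(j - sigma (tau j))%:~R| <= `|M1| + 1 :> R.
    rewrite rmorphB/= -[X in `|X|](subrKA (ln (rho (expR (tau j)%:~R)))).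
    by apply: le_trans (ler_normD _ _) _; exact: lerD.
  rewrite expRK -!expRD ler_expR.
  apply: (@le_trans _ _ (N * `|M1|)); first by apply: ler_wpM2l; first exact: ltW.
  by rewrite lerDl mulN1r subr_ge0.
apply: (@le_trans _ _ (CB%:E * lq q (sample F))%E); last first.
  by apply: lee_mulW; [exact: lq_ge0|rewrite lerDr ltW].
apply: (HB tau) => // k; apply: le_ereal_sup_tmp.
exists ((B * expR (-1 * `|(k - tau (sigma k))%:~R|))%:E * sample F (sigma k))%E.
  by exists (sigma k).
apply: le_trans (HF _ _ (rho0 _ (e0 k)) (e0 (sigma k))) _.
apply: lee_mulW; first exact: x0.
rewrite -!mulrA; apply: ler_wpM2l; first exact: ltW.
have h1 := le_trans (Htau (sigma k)) (ler_norm M1).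
have h2 := Hsigma k.
have h3 : `|(k - tau (sigma k))%:~R| <= `|M2| + D2 * (`|M1| + 1) :> R.
  have := H2 _ _ (e0 k) (e0 (tau (sigma k))); rewrite !expRK -rmorphB/=.
  move=> /le_trans; apply; apply: lerD; first exact: ler_norm.
  apply: ler_wpM2l; first exact: ltW.
  rewrite -[X in `|X|](subrKA ((sigma k)%:~R)).
  by apply: le_trans (ler_normD _ _) _; rewrite addrC; apply: lerD => //; rewrite distrC.
rewrite expRK -!expRD ler_expR.
apply: (@le_trans _ _ N); first by rewrite ler_piMr// ltW.
by rewrite lerDl mulN1r subr_ge0.
Qed.

End change_of_variables.

Lemma ecomp_same_space {R : realType} {V : Type} (X Y : V -> \bar R) (C : R) :
  0 < C -> (forall f, ecomp C (X f) (Y f)) -> same_space X Y.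
Proof.
move=> C0 XY.
have emb (X' Y' : V -> \bar R) : (forall f, (Y' f <= C%:E * X' f)%E) ->
    cont_embedded X' Y'.
  move=> le; split; last by exists C => // f _; exact: le.
  move=> f; rewrite /carrier/= => Xf; apply: le_lt_trans (le f) _.
  by apply: lte_mul_pinfty; rewrite ?lee_fin ?(ltW C0).
by split; apply: emb => f; have [] := XY f.
Qed.

(** * The two reiteration formulas *)

Section reiteration.
Context {R : realType} {k : scalar_kind} {V : topologicalLmodType (scalars R k)}.
Context (A0 A1 : V -> \bar R) (theta0 theta1 : R) (q1 r r1 r0 : \bar R).
Context (a a1 b0 b1 : R -> R).
Hypotheses (A_couple : compatible_couple A0 A1)
  (theta0_gt0 : 0 < theta0) (theta01 : theta0 < theta1) (theta1_lt1 : theta1 < 1)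
  (q1_gt0 : (0 < q1)%E) (r_gt0 : (0 < r)%E) (r1_gt0 : (0 < r1)%E) (r0_gt0 : (0 < r0)%E)
  (pa : potter a) (pa1 : potter a1) (pb0 : potter b0) (pb1 : potter b1)
  (tail_fin : (tail_norm r1 (fun s => (b1 s / a1 s)%R) 1 < +oo)%E).
Implicit Types (f : V) (j n : int) (theta : R).
Local Open Scope ereal_scope.

Let c1 := c1_weight r1 a1 b1.
Let rho := rho_weight theta0 theta1 r1 a1 b0 b1.
Let X0 := interp A0 A1 theta0 r0 b0.
Let X1 := interpL A0 A1 theta1 r1 b1 q1 a1.
Let delta := (theta1 - theta0)%R.
Let v t := (b0 t / c1 t)%R.
Let e n : R := expR n%:~R.
Let K f t := Kfun A0 A1 t f.
Let Kx f t := Kfun X0 X1 t f.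
Let G f := sample (weighted theta0 b0 (K f)).
Let I f n := lq r0 (lower n (G f)).
Let W theta n : R := (rho (e n) `^ (- theta) * a (rho (e n)))%R.

Let pc1 : potter c1.
Proof. exact: (potter_c1_weight r1_gt0 pa1 pb1 tail_fin). Qed.
Let pv : potter v. Proof. exact: (potter_div pb0 pc1). Qed.
Let e_gt0 n : (0 < e n)%R. Proof. exact: expR_gt0. Qed.
Let delta0 : (0 < delta)%R. Proof. by rewrite subr_gt0. Qed.

Let rho_gt0 t : (0 < t)%R -> (0 < rho t)%R.
Proof. exact: (rho_weight_gt0 _ _ r1_gt0 pa1 pb0 pb1 tail_fin). Qed.

Let pa_rho : potter (fun t => a (rho t)).
Proof.
apply: potter_comp => //; have [M [D [D0 H]]] := ln_power_potter_le delta0 pv.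
by exists M, D.
Qed.

Let rK f : regular (K f). Proof. exact: regular_K A_couple f. Qed.
Let X0_ge0 f : 0 <= X0 f. Proof. exact: Lq_ge0. Qed.
Let X1_ge0 f : 0 <= X1 f. Proof. exact: Lq_ge0. Qed.

Let rKx f : regular (Kx f).
Proof.
by split=> [t t0|s t s0 t0]; [exact: Kfun_ge0|exact: Kfun_regular].
Qed.

Let G0 f n : 0 <= G f n. Proof. exact: sample_weighted_ge0. Qed.
Let I0 f n : 0 <= I f n. Proof. exact/lq_ge0/lower_ge0. Qed.
Let W_gt0 theta n : (0 < W theta n)%R.
Proof. by rewrite mulr_gt0 ?powR_gt0 ?rho_gt0//; apply: pa.1; exact: rho_gt0. Qed.
Let W0 theta n : 0 <= (W theta n)%:E. Proof. by rewrite lee_fin ltW. Qed.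
Let Kx0 f n : 0 <= Kx f (rho (e n)). Proof. by apply: (rKx f).1; exact: rho_gt0. Qed.

(** The Holmstedt estimates control the K-functional of (X0,X1) at the points rho(e^n), while plain
    sampling evaluates it at e^n. *)
Lemma interp_couple_sample theta : exists2 C : R, (0 < C)%R & forall f,
  ecomp C (interp X0 X1 theta r a f)
    (lq r (fun n => (W theta n)%:E * Kx f (rho (e n)))).
Proof.
have [A A_gt0 HA] := interp_sample theta r_gt0 pa.
have [M M0 HM] := weighted_le theta pa.
have N0 : (0 < `|theta| + 2)%R by rewrite ltr_wpDl.
have [B B0 HB] := lq_change delta0 pv r_gt0 N0 M0.
exists (A * B)%R; first exact: mulr_gt0.
move=> f; apply: ecomp_trans A_gt0 B0 (HA _ (rKx f)) _.
apply: HB; last by apply: HM; exact: rKx.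
by move=> t t0; apply: weighted_ge0 => //; exact: rKx.
Qed.

(** The slowly varying part of [W]. The exponential part makes W decay when theta > 0 and W rho grow
    when theta < 1; these two facts drive the two absorptions. *)
Let p theta t := (v t `^ (- theta) * a (rho t))%R.
Let pp theta : potter (p theta). Proof. exact/potterM/pa_rho/potter_powR. Qed.

Let W_E theta n : W theta n = (expR (- (theta * delta) * n%:~R) * p theta (e n))%R.
Proof.
rewrite /W /p /rho rho_weightE -/c1 -/(v _) powRM ?expR_ge0//; last first.
  by rewrite ltW// pv.1.
rewrite -mulrA; congr (_ * _)%R; rewrite -expRM; congr expR.
by rewrite /delta; ring.
Qed.

Let Wrho_E theta n : (W theta n * rho (e n) =
  expR ((1 - theta) * delta * n%:~R) * (p theta (e n) * v (e n)))%R.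
Proof.
rewrite W_E /rho rho_weightE -/c1 -/(v _) -/delta.
rewrite (_ : ((1 - theta) * delta * n%:~R) =
  - (theta * delta) * n%:~R + delta * n%:~R)%R; last by ring.
by rewrite expRD; ring.
Qed.

Lemma weighted_lower_le theta : exists2 C : R, (0 < C)%R & forall f,
  lq r (fun n => (W theta n)%:E * I f n) <=
  C%:E * lq r (fun n => (W theta n)%:E * Kx f (rho (e n))).
Proof.
have [C C0 HC] := holmstedt_lower A_couple theta01 q1_gt0 r1_gt0 r0_gt0 pa1 pb0
  pb1 tail_fin.
exists C => // f; rewrite -lqZ//; last by move=> n; exact: mule_ge0.
apply: le_lq => // n; first exact: mule_ge0.
by rewrite muleCA; apply: lee_wpmul2l => //; exact: HC.
Qed.

Let G_le_I f n : G f n <= I f n.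
Proof.
rewrite [leLHS](_ : _ = lower n (G f) n); last by rewrite /lower lexx.
by apply: lq_ge => //; exact: lower_ge0.
Qed.

(** In the remainder, [S f j] is [G f j] over rho(e^j), so with j >= n it carries the quotient of W
    rho at n and at j, which is geometrically small in j - n. The Hardy inequality bounds it by the
    norm of W G, hence of W I. *)
Lemma weighted_upper_le theta : (theta < 1)%R -> exists2 C : R, (0 < C)%R & forall f,
  lq r (fun n => (W theta n)%:E * Kx f (rho (e n))) <=
  C%:E * lq r (fun n => (W theta n)%:E * I f n).
Proof.
move=> theta1'; have d0 : (0 < (1 - theta) * delta)%R by rewrite mulr_gt0 ?subr_gt0.
have [B B0 HB] := potter_growth (potterM (pp theta) pv) d0.
(* Slow variation leaves half of (1 - theta) delta; the factor (u/t)^nu inside [U] takes half of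
   that, and nu remains for the kernel. *)
set nu := ((1 - theta) * delta / 2 / 2)%R.
have nu0 : (0 < nu)%R by rewrite !divr_gt0.
have [C C0 HC] := holmstedt_upper A_couple theta0_gt0 theta1_lt1 q1_gt0
  r1_gt0 r0_gt0 pa1 pb0 pb1 tail_fin nu0.
have [D D0 HD] := lqD r_gt0.
have [E E0 HE] := lq_hardy r_gt0 B0 nu0.
exists (C * (D * (1 + E)))%R; first by rewrite !mulr_gt0// addr_gt0.
move=> f; pose U n := ereal_sup (range (fun j => (expR (nu * `|(j - n)%:~R|))%:E *
  upper n (sample (weighted theta1 c1 (K f))) j)).
have U0 n : 0 <= U n.
  apply: le_ereal_sup_tmp; exists ((expR (nu * `|(n - n)%:~R|))%:E *
    upper n (sample (weighted theta1 c1 (K f))) n); first by exists n.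
  rewrite mule_ge0 ?lee_fin ?expR_ge0//; apply: upper_ge0 => j.
  exact: sample_weighted_ge0.
pose x n := (W theta n)%:E * I f n.
pose y n := (W theta n)%:E * ((rho (e n))%:E * U n).
have x0 n : 0 <= x n by exact: mule_ge0.
have y0 n : 0 <= y n.
  by rewrite mule_ge0// mule_ge0// lee_fin ltW// rho_gt0.
have z0 n : 0 <= (W theta n)%:E * G f n by exact: mule_ge0.
apply: (@le_trans _ _ (lq r (fun n => C%:E * (x n + y n)))).
  apply: le_lq => // n; first exact: mule_ge0.
  rewrite /x /y -ge0_muleDr//; last by rewrite mule_ge0// lee_fin ltW// rho_gt0.
  by rewrite [leRHS]muleCA; apply: lee_wpmul2l => //; exact: HC.
rewrite lqZ//; last by move=> n; exact: adde_ge0.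
rewrite EFinM -muleA; apply: lee_wpmul2l; first by rewrite lee_fin ltW.
apply: le_trans (HD _ _ x0 y0) _; rewrite EFinM -muleA.
apply: lee_wpmul2l; first by rewrite lee_fin ltW.
rewrite EFinD ge0_muleDl ?lee_fin ?(ltW E0)// mul1e; apply: leeD => //.
apply: (@le_trans _ _ (E%:E * lq r (fun n => (W theta n)%:E * G f n))); last first.
  apply: lee_wpmul2l; first by rewrite lee_fin ltW.
  by apply: le_lq => // n; apply: lee_wpmul2l => //; exact: G_le_I.
apply: (HE id) => // n; rewrite /y muleA -EFinM.
have Wr0 : (0 < W theta n * rho (e n))%R by rewrite mulr_gt0 ?rho_gt0.
rewrite -lee_pdivlMl//; apply: ge_ereal_sup => _ [j _ <-]; rewrite lee_pdivlMl//.
rewrite /upper; case: ifPn => [nj|_]; last first.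
  rewrite !mule0; apply: le_ereal_sup_tmp.
  exists ((B * expR (- nu * `|(n - n)%:~R|))%:E * ((W theta n)%:E * G f n)).
    by exists n.
  by rewrite mule_ge0// lee_fin mulr_ge0 ?expR_ge0// ltW.
apply: le_ereal_sup_tmp.
exists ((B * expR (- nu * `|(n - j)%:~R|))%:E * ((W theta j)%:E * G f j)).
  by exists j.
rewrite /G (sample_rho_weight A0 A1 theta0 theta1 b0 r1_gt0 pa1 pb1 tail_fin).
rewrite -/rho -/(e j) [X in _ <= _ * X]muleA [leRHS]muleA [leLHS]muleA -!EFinM.
apply: lee_mulW; first exact: sample_weighted_ge0.
rewrite -[leRHS]mulrA !Wrho_E; apply: le_trans (ler_wpM2r (expR_ge0 _) (HB _ _ nj)) _.
rewrite -/(e j) [leRHS]mulrA [leLHS]mulrAC; apply: ler_wpM2r.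
  by rewrite mulr_ge0 ?expR_ge0// mulr_ge0// ltW// ?(pp _).1 ?pv.1.
rewrite -mulrA -expRD; apply: ler_wpM2l; first exact: ltW.
rewrite -[in (j - n)%R]opprB rmorphN normrN ler_expR le_eqVlt.
by apply/orP; left; apply/eqP; rewrite /nu; field.
Qed.

(** The inner norm is estimated by a supremum with a geometric kernel before the outer norm is
    taken, so r and r0 need no relation. The kernel comes from the decay of W, present only for
    theta > 0. *)
Lemma weighted_hardy theta : (0 < theta)%R -> exists2 C : R, (0 < C)%R & forall f,
  lq r (fun n => (W theta n)%:E * I f n) <=
  C%:E * lq r (fun n => (W theta n)%:E * G f n).
Proof.
move=> theta_gt0; have d0 : (0 < theta * delta)%R by rewrite mulr_gt0.
have [B B0 HB] := potter_decay (pp theta) d0.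
(* Of the half of theta delta that slow variation leaves, one half sums the inner l_{r0} norm and
   the other is the kernel of the outer inequality. *)
set nu := (theta * delta / 2 / 2)%R.
have nu0 : (0 < nu)%R by rewrite !divr_gt0.
have [L L0 HL] := lq_geo r0_gt0 nu0.
have LB0 : (0 < L * B)%R by exact: mulr_gt0.
have [E E0 HE] := lq_hardy r_gt0 LB0 nu0.
exists E => // f; apply: (HE id) => [n|n|n]; [exact: mule_ge0|exact: mule_ge0|].
set S := ereal_sup _.
have S0 : 0 <= S.
  apply: le_ereal_sup_tmp; exists ((L * B * expR (- nu * `|(n - id n)%:~R|))%:E *
    ((W theta n)%:E * G f n)); first by exists n.
  apply: mule_ge0; last exact: mule_ge0.
  by rewrite lee_fin; apply: mulr_ge0; [exact: ltW|exact: expR_ge0].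
have Li0 : (0 < L^-1)%R by rewrite invr_gt0.
have Wi0 : (0 < (W theta n)^-1)%R by rewrite invr_gt0.
rewrite -lee_pdivlMl// [leRHS](_ : _ = (L * (L^-1 * (W theta n)^-1))%:E * S); last first.
  by rewrite mulrA divff ?mul1r// gt_eqF.
apply: (HL n) => //; [exact: mulr_gt0|exact: lower_ge0|].
move=> j; rewrite /lower; case: ifPn => [jn|_]; last first.
  apply: mule_ge0 => //; rewrite lee_fin; apply: mulr_ge0; last exact: expR_ge0.
  by apply: mulr_ge0; exact: ltW.
rewrite [X in X%:E * S](_ : _ =
    (L * W theta n * expR (nu * `|(j - n)%:~R|))^-1)%R; last first.
  by rewrite !invfM mulNr expRN.
rewrite lee_pdivlMl; last by apply: mulr_gt0; [exact: mulr_gt0|exact: expR_gt0].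
apply: le_ereal_sup_tmp.
exists ((L * B * expR (- nu * `|(n - id j)%:~R|))%:E * ((W theta j)%:E * G f j)).
  by exists j.
rewrite [leRHS]muleA -EFinM; apply: lee_mulW => //.
rewrite -(mulrA L (W theta n)) -(mulrA L B) -(mulrA L (B * expR _)%R).
apply: ler_wpM2l; first exact: ltW.
rewrite !W_E; apply: le_trans (ler_wpM2r (expR_ge0 _) (HB _ _ jn)) _.
rewrite -/(e j) [leLHS]mulrAC; apply: ler_wpM2r.
  by rewrite mulr_ge0 ?expR_ge0// ltW// (pp _).1.
rewrite -mulrA -expRD; apply: ler_wpM2l; first exact: ltW.
rewrite -[in (j - n)%R]opprB rmorphN normrN ler_expR le_eqVlt.
by apply/orP; left; apply/eqP; rewrite /nu; field.
Qed.

Lemma reiteration theta : (0 < theta)%R -> (theta < 1)%R ->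
  same_space (interp X0 X1 theta r a)
    (interp A0 A1 ((1 - theta) * theta0 + theta * theta1)%R r
      (fun t => b0 t `^ (1 - theta) * c1 t `^ theta * a (rho t))%R).
Proof.
move=> theta_gt0 theta_lt1.
set eta := ((1 - theta) * theta0 + theta * theta1)%R.
set a' := (fun t => b0 t `^ (1 - theta) * c1 t `^ theta * a (rho t))%R.
have pa' : potter a' by apply: potterM pa_rho; apply: potterM; exact: potter_powR.
have [CX CX0 HX] := interp_couple_sample theta.
have [CA CA0 HA] := interp_sample eta r_gt0 pa'.
have [CL CL0 HL] := weighted_lower_le theta.
have [CU CU0 HU] := weighted_upper_le theta_lt1.
have [CH CH0 HH] := weighted_hardy theta_gt0.
(* An exact identity, and the origin of the parameters: eta = theta0 + theta delta, and b0^(1-theta)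
   c1^theta = b0 v^(-theta). *)
have aE f : sample (weighted eta a' (K f)) = fun n => (W theta n)%:E * G f n.
  apply/funext => n; rewrite /G !sample_weighted muleA -EFinM; congr (_%:E * _).
  rewrite W_E /p /a' -/(e n).
  have b0_gt0 : (0 < b0 (e n))%R by exact: pb0.1.
  have c1_gt0 : (0 < c1 (e n))%R by exact: pc1.1.
  have -> : (v (e n) `^ (- theta) = b0 (e n) `^ (- theta) * c1 (e n) `^ theta)%R.
    rewrite /v powRM ?invr_ge0 ?ltW// -powR_inv1 ?ltW// -powRrM mulN1r opprK//.
  rewrite powRD ?(gt_eqF b0_gt0) ?implybT// powRr1 ?ltW//.
  have -> : (expR (- eta * n%:~R) =
      expR (- (theta * delta) * n%:~R) * expR (- theta0 * n%:~R) :> R)%R.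
    by rewrite -expRD; congr expR; rewrite /eta /delta; ring.
  by ring.
pose D := (1 + CU * CH)%R; have D0 : (0 < D)%R by rewrite addr_gt0// mulr_gt0.
have C0 : (0 < CL + D)%R by exact: addr_gt0.
apply: (@ecomp_same_space _ _ _ _ (CX * ((CL + D) * CA))%R).
  by rewrite !mulr_gt0.
move=> f; apply: ecomp_trans (HX f) _ => //; first exact: mulr_gt0.
apply: ecomp_trans (ecompC (HA _ (rK f))) => //; rewrite aE.
have WK0 n : 0 <= (W theta n)%:E * Kx f (rho (e n)) by exact: mule_ge0.
have WG0 n : 0 <= (W theta n)%:E * G f n by exact: mule_ge0.
split.
  apply: (@le_trans _ _ ((CU * CH)%:E * lq r (fun n => (W theta n)%:E * G f n))).
    exact: lee_trans_mul (HU f) (HH f).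
  apply: lee_mulW; first exact: lq_ge0.
  by rewrite /D addrA lerDr addr_ge0// ltW.
apply: (@le_trans _ _ (CL%:E * lq r (fun n => (W theta n)%:E * Kx f (rho (e n))))).
  apply: le_trans (HL f); apply: le_lq => // n.
  by apply: lee_wpmul2l => //; exact: G_le_I.
by apply: lee_mulW; [exact: lq_ge0|rewrite lerDl ltW].
Qed.

Lemma reiteration0 :
  same_space (interp X0 X1 0 r a)
    (interpL A0 A1 theta0 r (fun t => b0 t * a (rho t))%R r0 b0).
Proof.
have pa' : potter (fun t => b0 t * a (rho t))%R by exact: potterM.
have [CX CX0 HX] := interp_couple_sample 0.
have [CA CA0 HA] := interpL_sample theta0 r_gt0 r0_gt0 pa' pb0.
have [CL CL0 HL] := weighted_lower_le 0.
have [CU CU0 HU] := weighted_upper_le (@ltr01 R).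
have C0 : (0 < CL + CU)%R by exact: addr_gt0.
apply: (@ecomp_same_space _ _ _ _ (CX * ((CL + CU) * CA))%R).
  by rewrite !mulr_gt0.
move=> f; apply: ecomp_trans (HX f) _ => //; first exact: mulr_gt0.
apply: ecomp_trans (ecompC (HA _ (rK f))) => //.
(* The space of type L divides its outer weight by its inner one; here b0 cancels and a(rho), which
   is W at theta = 0, remains in front of [I]. *)
have WE : (fun n => (b0 (e n) * a (rho (e n)) / b0 (e n))%:E * I f n) =
    fun n => (W 0 n)%:E * I f n.
  apply/funext => n; congr (_%:E * _); rewrite /W oppr0 powRr0 mul1r mulrC mulKf//.
  by rewrite gt_eqF// pb0.1.
rewrite -/(K f) -/(G f) WE.
have WK0 n : 0 <= (W 0 n)%:E * Kx f (rho (e n)) by exact: mule_ge0.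
have WI0 n : 0 <= (W 0 n)%:E * I f n by exact: mule_ge0.
split.
  by apply: le_trans (HU f) _; apply: lee_mulW; [exact: lq_ge0|rewrite lerDr ltW].
by apply: le_trans (HL f) _; apply: lee_mulW; [exact: lq_ge0|rewrite lerDl ltW].
Qed.

End reiteration.
Theorem theorem18 (R : realType) (k : scalar_kind)
    (V : topologicalLmodType (scalars R k)) (A0 A1 : V -> \bar R)
    (theta0 theta1 : R) (q1 r r1 r0 : \bar R) (a a1 b0 b1 : R -> R)
    (A_couple : compatible_couple A0 A1)
    (A_meet : exists x, [/\ x <> 0, carrier A0 x & carrier A1 x])
    (theta0_gt0 : 0 < theta0) (theta01 : theta0 < theta1) (theta1_lt1 : theta1 < 1)
    (q1_gt0 : (0 < q1)%E) (r_gt0 : (0 < r)%E)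
    (r1_gt0 : (0 < r1)%E) (r0_gt0 : (0 < r0)%E)
    (a_sv : slowly_varying a) (a1_sv : slowly_varying a1)
    (b0_sv : slowly_varying b0) (b1_sv : slowly_varying b1)
    (tail_fin : (tail_norm r1 (fun s => (b1 s / a1 s)%R) 1 < +oo)%E) :
  let c1 t := a1 t * fine (tail_norm r1 (fun s => (b1 s / a1 s)%R) t) in
  let rho t := t `^ (theta1 - theta0) * (b0 t / c1 t) in
  let X0 := interp A0 A1 theta0 r0 b0 in
  let X1 := interpL A0 A1 theta1 r1 b1 q1 a1 in
  (forall theta : R, 0 < theta -> theta < 1 ->
     let eta := (1 - theta) * theta0 + theta * theta1 in
     let a_sharp t := b0 t `^ (1 - theta) * c1 t `^ theta * a (rho t) in
     same_space (interp X0 X1 theta r a) (interp A0 A1 eta r a_sharp))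
  /\
  ((tail_norm r a 1 < +oo)%E ->
     let a_sharp t := b0 t * a (rho t) in
     same_space (interp X0 X1 0 r a) (interpL A0 A1 theta0 r a_sharp r0 b0)).
Proof.
have pa := slowly_varying_potter a_sv; have pa1 := slowly_varying_potter a1_sv.
have pb0 := slowly_varying_potter b0_sv; have pb1 := slowly_varying_potter b1_sv.
by move=> c1 rho X0 X1; split=> [theta theta_gt0 theta_lt1 eta a_sharp|_ a_sharp];
  [exact: reiteration|exact: reiteration0].
Qed.
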